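(* For any $i\neq j$ in $I$, the following identities hold between linear operators on $U^+_{r,s}$ (products being compositions): $$\text{(i)}\quad \sum_{k=0}^{1-a_{ij}}(-1)^k\binom{1-a_{ij}}{k}_{r_is_i^{-1}}c_{ij}^{(k)}\,\partial_i^{\,1-a_{ij}-k}\,\partial_j\,\partial_i^{\,k}=0,$$ $$\text{(ii)}\quad \sum_{k=0}^{1-a_{ij}}(-1)^k\binom{1-a_{ij}}{k}_{r_is_i^{-1}}c_{ij}^{(k)}\,\partial_i'^{\,1-a_{ij}-k}\,\partial_j'\,\partial_i'^{\,k}=0.$$ Consequently there are two operator realizations of $U^+_{r,s}$, i.e. unital $\mathbb{Q}(r,s)$-algebra homomorphisms $U^+_{r,s}\to\mathrm{End}_{\mathbb{Q}(r,s)}(U^+_{r,s})$, given by $e_i\mapsto\partial_i$ $(i\in I)$ and by $e_i\mapsto\partial_i'$ $(i\in I)$ respectively.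
   Context: Let $C=(a_{ij})_{i,j\in I}$, $I=\{1,\dots,n\}$, be a Cartan matrix of finite type, $\mathfrak g$ the associated semisimple Lie algebra, and $\{d_i\mid i\in I\}$ relatively prime positive integers with $d_ia_{ij}=d_ja_{ji}$. Let $\mathbb{Q}(r,s)$ be the field of rational functions in two variables, $r_i=r^{d_i}$, $s_i=s^{d_i}$. Let $Q=\bigoplus_{i\in I}\mathbb{Z}\alpha_i$ be the root lattice. The Euler form is the bilinear form on $Q$ with $\langle i,j\rangle:=\langle\alpha_i,\alpha_j\rangle=d_ia_{ij}$ if $i<j$, $=d_i$ if $i=j$, and $=0$ if $i>j$. $U_{r,s}(\mathfrak g)$ is the unital associative $\mathbb{Q}(r,s)$-algebra generated by $e_i,f_i,\omega_i^{\pm1},\omega_i'^{\pm1}$ ($i\in I$) with relations: (R1) all $\omega_i^{\pm1},\omega_j'^{\pm1}$ commute with one another and $\omega_i\omega_i^{-1}=\omega_i'\omega_i'^{-1}=1$; (R2) $\omega_ie_j\omega_i^{-1}=r^{\langle j,i\rangle}s^{-\langle i,j\rangle}e_j$, $\ \omega_i'e_j\omega_i'^{-1}=r^{-\langle i,j\rangle}s^{\langle j,i\rangle}e_j$; (R3) $\omega_if_j\omega_i^{-1}=r^{-\langle j,i\rangle}s^{\langle i,j\rangle}f_j$, $\ \omega_i'f_j\omega_i'^{-1}=r^{\langle i,j\rangle}s^{-\langle j,i\rangle}f_j$; (R4) $e_if_j-f_je_i=\delta_{i,j}\dfrac{\omega_i-\omega_i'}{r_i-s_i}$; (R5) for $i\ne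 j$: $\sum_{k=0}^{1-a_{ij}}(-1)^k\binom{1-a_{ij}}{k}_{r_is_i^{-1}}c_{ij}^{(k)}\,e_i^{1-a_{ij}-k}e_je_i^k=0$; (R6) for $i\ne j$: $\sum_{k=0}^{1-a_{ij}}(-1)^k\binom{1-a_{ij}}{k}_{r_is_i^{-1}}c_{ij}^{(k)}\,f_i^{k}f_jf_i^{1-a_{ij}-k}=0$; where $c_{ij}^{(k)}=(r_is_i^{-1})^{k(k-1)/2}r^{k\langle j,i\rangle}s^{-k\langle i,j\rangle}$, $(n)_v=\frac{v^n-1}{v-1}$, $(n)_v!=(1)_v\cdots(n)_v$, $(0)_v!=1$, $\binom{n}{k}_v=\frac{(n)_v!}{(k)_v!(n-k)_v!}$. $U^+_{r,s}$ is the subalgebra generated by the $e_i$ ($i\in I$). Skew differential operators: for each $i\in I$ and each $P\in U^+_{r,s}$ there exist unique $L,R\in U^+_{r,s}$ with $Pf_i-f_iP=\dfrac{\omega_iL-\omega_i'R}{r_i-s_i}$; one sets $\partial_i(P)=L$ and $\partial_i'(P)=R$, which defines linear operators $\partial_i,\partial_i'$ on $U^+_{r,s}$. *)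

(* Defs.v *)
From HB Require Import structures.
From mathcomp Require Import all_boot all_order all_algebra generic_quotient.
From mathcomp Require Import boolp classical_sets.
From mathcomp Require Import finmap monalg.

Set Implicit Arguments.
Unset Strict Implicit.
Unset Printing Implicit Defensive.

Import Order.TTheory GRing.Theory Num.Theory.
Local Open Scope ring_scope.
Local Open Scope quotient_scope.

(* The two-sided ideal generated by the differences x - y with [rel x y]. In a
   unital algebra it is automatically closed under scaling. *)
Inductive rel_ideal (A : pzRingType) (rel : A -> A -> Prop) : A -> Prop :=
| RelIdeal_rel x y : rel x y -> rel_ideal rel (x - y)
| RelIdeal_0 : rel_ideal rel 0
| RelIdeal_D x y : rel_ideal rel x -> rel_ideal rel y -> rel_ideal rel (x + y)
| RelIdeal_Ml a x : rel_ideal rel x -> rel_ideal rel (a * x)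
| RelIdeal_Mr a x : rel_ideal rel x -> rel_ideal rel (x * a).

(* An [algType] is non-trivial, so the quotient algebra carries a proof
   that the ideal is proper. *)
Section QuotAlg.
Variables (F : fieldType) (A : algType F) (rel : A -> A -> Prop).
Variable rel_proper : ~ rel_ideal rel 1.

Definition qa_equiv (x y : A) : bool := `[< rel_ideal rel (x - y) >].

Lemma qa_relN x : rel_ideal rel x -> rel_ideal rel (- x).
Proof. by rewrite -mulN1r; exact: RelIdeal_Ml. Qed.

Lemma qa_equiv_is_equiv : equiv_class_of qa_equiv.
Proof.
split=> [x|x y|y x z].
- by apply/asboolP; rewrite subrr; exact: RelIdeal_0.
- by apply/asboolP/asboolP => /qa_relN; rewrite opprB.
- move=> /asboolP xy /asboolP yz; apply/asboolP.
  by rewrite -[x](addrNK y) -addrA; exact: RelIdeal_D.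
Qed.

Canonical qa_equiv_equiv := EquivRelPack qa_equiv_is_equiv.
Canonical qa_equiv_encModRel := defaultEncModRel qa_equiv.

Definition quot_alg of ~ rel_ideal rel 1 := {eq_quot qa_equiv}.
Local Notation Q := (quot_alg rel_proper).

HB.instance Definition _ : EqQuotient A qa_equiv Q := EqQuotient.on Q.
HB.instance Definition _ := Choice.on Q.

Lemma quot_algP (x y : A) : (\pi_Q x = \pi_Q y) <-> rel_ideal rel (x - y).
Proof.
split=> [/eqP|h]; first by rewrite piE => /asboolP.
by apply/eqP; rewrite piE; apply/asboolP.
Qed.

Definition qa_zero : Q := \pi_Q 0.
Definition qa_one : Q := \pi_Q 1.
Definition qa_opp := lift_op1 Q -%R.
Definition qa_add := lift_op2 Q +%R.
Definition qa_mul := lift_op2 Q *%R.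
Definition qa_scale (a : F) := lift_op1 Q ( *:%R a).

Lemma qa_repr_pi (x : A) : rel_ideal rel (repr (\pi_Q x) - x).
Proof. by apply/quot_algP; rewrite reprK. Qed.

Lemma qa_pi_opp x : qa_opp (\pi_Q x) = \pi_Q (- x).
Proof. by unlock qa_opp; apply/quot_algP; rewrite -opprD; apply/qa_relN/qa_repr_pi. Qed.

Lemma qa_pi_add x y : qa_add (\pi_Q x) (\pi_Q y) = \pi_Q (x + y).
Proof.
unlock qa_add; apply/quot_algP; rewrite opprD addrACA.
by apply: RelIdeal_D; exact: qa_repr_pi.
Qed.

Lemma qa_pi_mul x y : qa_mul (\pi_Q x) (\pi_Q y) = \pi_Q (x * y).
Proof.
unlock qa_mul; apply/quot_algP; rewrite -(subrKA (x * repr (\pi_Q y))) -mulrBl -mulrBr.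
apply: RelIdeal_D; [apply: RelIdeal_Mr|apply: RelIdeal_Ml]; exact: qa_repr_pi.
Qed.

Lemma qa_pi_scale a x : qa_scale a (\pi_Q x) = \pi_Q (a *: x).
Proof.
unlock qa_scale; apply/quot_algP; rewrite -scalerBr -mulr_algl.
exact/RelIdeal_Ml/qa_repr_pi.
Qed.

Lemma qa_addA : associative qa_add.
Proof.
by move=> x y z; rewrite -[x]reprK -[y]reprK -[z]reprK !qa_pi_add addrA.
Qed.
Lemma qa_addC : commutative qa_add.
Proof. by move=> x y; rewrite -[x]reprK -[y]reprK !qa_pi_add addrC. Qed.
Lemma qa_add0 : left_id qa_zero qa_add.
Proof. by move=> x; rewrite -[x]reprK qa_pi_add add0r. Qed.
Lemma qa_addN : left_inverse qa_zero qa_opp qa_add.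
Proof. by move=> x; rewrite -[x]reprK qa_pi_opp qa_pi_add addNr. Qed.

HB.instance Definition _ := GRing.isZmodule.Build Q qa_addA qa_addC qa_add0 qa_addN.

Lemma qa_mulA : associative qa_mul.
Proof.
by move=> x y z; rewrite -[x]reprK -[y]reprK -[z]reprK !qa_pi_mul mulrA.
Qed.
Lemma qa_mul1 : left_id qa_one qa_mul.
Proof. by move=> x; rewrite -[x]reprK qa_pi_mul mul1r. Qed.
Lemma qa_mulr1 : right_id qa_one qa_mul.
Proof. by move=> x; rewrite -[x]reprK qa_pi_mul mulr1. Qed.
Lemma qa_mulDl : left_distributive qa_mul qa_add.
Proof.
move=> x y z; rewrite -[x]reprK -[y]reprK -[z]reprK.
by rewrite !(qa_pi_mul, qa_pi_add) mulrDl.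
Qed.
Lemma qa_mulDr : right_distributive qa_mul qa_add.
Proof.
move=> x y z; rewrite -[x]reprK -[y]reprK -[z]reprK.
by rewrite !(qa_pi_mul, qa_pi_add) mulrDr.
Qed.
Lemma qa_one_neq0 : qa_one != qa_zero.
Proof.
by apply/eqP => /quot_algP; rewrite subr0; exact: rel_proper.
Qed.

HB.instance Definition _ := GRing.Zmodule_isNzRing.Build Q
  qa_mulA qa_mul1 qa_mulr1 qa_mulDl qa_mulDr qa_one_neq0.

Lemma qa_scaleA a b x : qa_scale a (qa_scale b x) = qa_scale (a * b) x.
Proof. by rewrite -[x]reprK !qa_pi_scale scalerA. Qed.
Lemma qa_scale1 : left_id 1 qa_scale.
Proof. by move=> x; rewrite -[x]reprK qa_pi_scale scale1r. Qed.
Lemma qa_scaleDr : right_distributive qa_scale +%R.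
Proof.
move=> a x y; rewrite -[x]reprK -[y]reprK.
by rewrite -[\pi_Q _ + _]/(qa_add _ _) -[qa_scale _ _ + _]/(qa_add _ _)
           !(qa_pi_scale, qa_pi_add) scalerDr.
Qed.
Lemma qa_scaleDl x : {morph qa_scale^~ x : a b / a + b}.
Proof.
move=> a b; rewrite -[x]reprK -[RHS]/(qa_add _ _).
by rewrite !(qa_pi_scale, qa_pi_add) scalerDl.
Qed.

HB.instance Definition _ := GRing.Zmodule_isLmodule.Build F Q
  qa_scaleA qa_scale1 qa_scaleDr qa_scaleDl.

Lemma qa_scaleAl a (x y : Q) : a *: (x * y) = (a *: x) * y.
Proof.
rewrite -[x]reprK -[y]reprK -[LHS]/(qa_scale a (qa_mul _ _)).
by rewrite -[RHS]/(qa_mul (qa_scale a _) _) !(qa_pi_scale, qa_pi_mul) scalerAl.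
Qed.
HB.instance Definition _ := GRing.Lmodule_isLalgebra.Build F Q qa_scaleAl.

Lemma qa_scaleAr a (x y : Q) : a *: (x * y) = x * (a *: y).
Proof.
rewrite -[x]reprK -[y]reprK -[LHS]/(qa_scale a (qa_mul _ _)).
by rewrite -[RHS]/(qa_mul _ (qa_scale a _)) !(qa_pi_scale, qa_pi_mul) scalerAr.
Qed.
HB.instance Definition _ := GRing.Lalgebra_isAlgebra.Build F Q qa_scaleAr.

End QuotAlg.

(* Multinomials declares the algebra structure of [malg] for commutative
   monoids only, hence this alias for the free algebra. *)
Section FreeAlgebra.
Variables (F : comNzRingType) (X : choiceType).

Lemma malg_scalerAr (a : F) (x y : {malg F[{fmonom X}]}) :
  a *: (x * y) = x * (a *: y).
Proof.
apply/malgP => k; rewrite mcoeffZ.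
have xyE := mcoeffMlw k (fsubset_refl (msupp x)) (fsubset_refl (msupp y)).
have xayE := mcoeffMlw k (fsubset_refl (msupp x)) (msuppZ_le a y).
apply: (etrans (congr1 ( *%R a) xyE)); apply: (etrans _ (esym xayE)).
rewrite mulr_sumr; apply: eq_bigr => k1 _; rewrite mulr_sumr.
by apply: eq_bigr => k2 _; rewrite mcoeffZ mulrnAr mulrCA.
Qed.

Definition free_alg := {malg F[{fmonom X}]}.
HB.instance Definition _ := GRing.Lalgebra.on free_alg.
HB.instance Definition _ :=
  GRing.Lalgebra_isAlgebra.Build F free_alg malg_scalerAr.

End FreeAlgebra.

(* Locked to keep unification from unfolding it. *)
HB.lock Definition free_gen (F : comNzRingType) (X : choiceType) (x : X) :
  free_alg F X := << fmu x >>.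

Section Character.
Variables (F : comNzRingType) (X : choiceType) (h : X -> F).
Let hm (m : {fmonom X}) : F := \prod_(x <- m : seq _) h x.
Let hm_morph : mmorphism hm.
Proof. by split=> [x y|]; rewrite /hm ?fmM ?big_cat // fm1 big_nil. Qed.
HB.instance Definition _ :=
  monalg.isMultiplicative.Build {fmonom X} F hm hm_morph.

Lemma free_alg_char : exists c : free_alg F X -> F,
  [/\ c 1 = 1, {morph c : x y / x + y}, {morph c : x y / x * y},
      forall a x, c (a *: x) = a * c x & forall x, c (free_gen F x) = h x].
Proof.
exists (mmap (@idfun F) hm); split.
- exact: (rmorph1 (mmap (@idfun F) hm)).
- exact: (rmorphD (mmap (@idfun F) hm)).
- exact: (rmorphM (mmap (@idfun F) hm)).
- exact: (linearZ_LR (mmap (@idfun F) hm)).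
- by move=> x; rewrite unlock mmapU /= mul1r /hm fmU big_seq1.
Qed.
End Character.

Inductive gen_subalg (F : fieldType) (A : algType F) (X : A -> Prop) : A -> Prop :=
| GenSubalg_gen x : X x -> gen_subalg X x
| GenSubalg_1 : gen_subalg X 1
| GenSubalg_lin a x y :
    gen_subalg X x -> gen_subalg X y -> gen_subalg X (a *: x + y)
| GenSubalg_M x y :
    gen_subalg X x -> gen_subalg X y -> gen_subalg X (x * y).

Section SubAlg.
Variables (F : fieldType) (A : algType F) (X : A -> Prop).

Definition subalg_pred : {pred A} := fun x => `[< gen_subalg X x >].

Lemma subalg_pred_closed : subalg_closed subalg_pred.
Proof.
split=> [|a x y /asboolP hx /asboolP hy|x y /asboolP hx /asboolP hy].
- exact/asboolP/GenSubalg_1.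
- exact/asboolP/GenSubalg_lin.
- exact/asboolP/GenSubalg_M.
Qed.
HB.instance Definition _ := GRing.isSubalgClosed.Build F A subalg_pred
  subalg_pred_closed.

Record subalg := Subalg { subalg_val : A; _ : subalg_val \in subalg_pred }.
HB.instance Definition _ := [isSub for subalg_val].
HB.instance Definition _ := [Choice of subalg by <:].
HB.instance Definition _ := [SubChoice_isSubAlgebra of subalg by <:].
End SubAlg.

(* Finite type: the symmetrized matrix is positive definite. Since it has
   integer entries, definiteness over the rationals and over the reals agree. *)
Definition cartan_finite_type (n : nat) (C : 'M[int]_n) : Prop :=
  [/\ forall i, C i i = 2,
      forall i j, i != j -> C i j <= 0,
      forall i j, C i j = 0 -> C j i = 0
    & exists D : 'I_n -> nat,
      [/\ forall i, (0 < D i)%N,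
          forall i j, (D i)%:Z * C i j = (D j)%:Z * C j i
        & forall x : 'rV[rat]_n, x != 0 ->
            0 < \sum_i \sum_j ((D i)%:Z * C i j)%:~R * x 0 i * x 0 j]].

Definition euler (n : nat) (C : 'M[int]_n) (d : 'I_n -> nat) (i j : 'I_n) : int :=
  if (i < j)%N then (d i)%:Z * C i j else if i == j then (d i)%:Z else 0.

Section VNumbers.
Variables (F : fieldType) (v : F).
Definition vint (n : nat) : F := (v ^+ n - 1) / (v - 1).
Definition vfact (n : nat) : F := \prod_(1 <= k < n.+1) vint k.
Definition vbinom (n k : nat) : F := vfact n / (vfact k * vfact (n - k)).
End VNumbers.

Inductive uq_gen (n : nat) : Type :=
| GenE of 'I_n | GenF of 'I_n
| GenW of 'I_n | GenWi of 'I_n      (* omega_i and its inverse *)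
| GenW' of 'I_n | GenWi' of 'I_n.   (* omega'_i and its inverse *)

HB.instance Definition _ (n : nat) := gen_eqMixin (uq_gen n).
HB.instance Definition _ (n : nat) := gen_choiceMixin (uq_gen n).

Definition uq_toral (n : nat) (g : uq_gen n) : bool :=
  match g with GenE _ | GenF _ => false | _ => true end.

Section Uq.
Variables (F : fieldType) (r s : F) (n : nat) (C : 'M[int]_n) (d : 'I_n -> nat).
Implicit Types i j : 'I_n.

Definition uq_r i : F := r ^+ d i.
Definition uq_s i : F := s ^+ d i.

(* For i != j the entry C i j is nonpositive, so the absolute value in
   [serre_len i j] is just a cast of 1 - C i j from int to nat. *)
Definition serre_len i j : nat := `|1 - C i j|%N.

Definition serre_c i j (k : nat) : F :=
  (uq_r i / uq_s i) ^+ (k * k.-1)./2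
  * r ^ (k%:Z * euler C d j i) * s ^ (- (k%:Z * euler C d i j)).

Definition serre_coef i j (k : nat) : F :=
  (-1) ^+ k * vbinom (uq_r i / uq_s i) (serre_len i j) k * serre_c i j k.

Section Relations.
Variables (A : algType F) (gen : uq_gen n -> A).

Local Notation E i := (gen (GenE i)).
Local Notation "'F_' i" := (gen (GenF i)) (at level 8, i at level 2).
Local Notation W i := (gen (GenW i)).
Local Notation Wi i := (gen (GenWi i)).
Local Notation W' i := (gen (GenW' i)).
Local Notation Wi' i := (gen (GenWi' i)).
Local Notation "<< i ; j >>" := (euler C d i j) (at level 0).

(* [uq_rel x y] holds when x = y is one of the defining relations. *)
Inductive uq_rel : A -> A -> Prop :=
| Uq_toral_comm g h : uq_toral g -> uq_toral h -> uq_rel (gen g * gen h) (gen h * gen g)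
| Uq_WV i : uq_rel (W i * Wi i) 1
| Uq_W'V i : uq_rel (W' i * Wi' i) 1
| Uq_WE i j : uq_rel (W i * E j * Wi i) ((r ^ <<j; i>> * s ^ (- <<i; j>>)) *: E j)
| Uq_W'E i j :
    uq_rel (W' i * E j * Wi' i) ((r ^ (- <<i; j>>) * s ^ <<j; i>>) *: E j)
| Uq_WF i j : uq_rel (W i * F_ j * Wi i) ((r ^ (- <<j; i>>) * s ^ <<i; j>>) *: F_ j)
| Uq_W'F i j :
    uq_rel (W' i * F_ j * Wi' i) ((r ^ <<i; j>> * s ^ (- <<j; i>>)) *: F_ j)
| Uq_EF i j :
    uq_rel (E i * F_ j - F_ j * E i)
      (((i == j)%:R / (uq_r i - uq_s i)) *: (W i - W' i))
| Uq_serreE i j : i != j ->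
    uq_rel (\sum_(k < (serre_len i j).+1)
              serre_coef i j k *: (E i ^+ (serre_len i j - k) * E j * E i ^+ k)) 0
| Uq_serreF i j : i != j ->
    uq_rel (\sum_(k < (serre_len i j).+1)
              serre_coef i j k *: (F_ i ^+ k * F_ j * F_ i ^+ (serre_len i j - k))) 0.

End Relations.

(* The augmentation e_i, f_i |-> 0, omega_i, omega'_i |-> 1 shows that the
   relations do not collapse the algebra. *)
Lemma uq_rel_proper (A : algType F) (gen : uq_gen n -> A) (c : A -> F) :
    c 1 = 1 -> {morph c : x y / x + y} -> {morph c : x y / x * y} ->
    (forall a x, c (a *: x) = a * c x) ->
    (forall g, c (gen g) = (uq_toral g)%:R) ->
  ~ rel_ideal (uq_rel gen) 1.
Proof.
move=> c1 cD cM cZ cg.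
suff c_ideal x : rel_ideal (uq_rel gen) x -> c x = 0.
  by move/c_ideal/eqP; rewrite c1 oner_eq0.
have c0 : c 0 = 0 by rewrite -(scale0r 1) cZ mul0r.
have cN y : c (- y) = - c y by rewrite -scaleN1r cZ mulN1r.
have cS m (f : 'I_m -> A) : (forall k, c (f k) = 0) -> c (\sum_k f k) = 0.
  by move=> f0; elim/big_ind: _ => // y z hy hz; rewrite cD hy hz addr0.
elim=> [y z yz||y z _ IHy _ IHz|a y _ IHy|a y _ IHy].
- rewrite cD cN; case: yz => [g h _ _|i|i|i j|i j|i j|i j|i j|i j _|i j _].
  + by rewrite !cM mulrC subrr.
  + by rewrite cM c1 !cg mulr1 subrr.
  + by rewrite cM c1 !cg mulr1 subrr.
  + by rewrite cZ !cM !cg !(mulr0, mul0r) subrr.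
  + by rewrite cZ !cM !cg !(mulr0, mul0r) subrr.
  + by rewrite cZ !cM !cg !(mulr0, mul0r) subrr.
  + by rewrite cZ !cM !cg !(mulr0, mul0r) subrr.
  + by rewrite cZ !cD !cN !cM !cg !mulr0 !subrr mulr0 subr0.
  + by rewrite c0 subr0; apply: cS => k; rewrite cZ !cM !cg !(mulr0, mul0r).
  + by rewrite c0 subr0; apply: cS => k; rewrite cZ !cM !cg !(mulr0, mul0r).
- exact: c0.
- by rewrite cD IHy IHz addr0.
- by rewrite cM IHy mulr0.
- by rewrite cM IHy mul0r.
Qed.

Definition uq_free := free_alg F (uq_gen n).
HB.instance Definition _ := GRing.Algebra.on uq_free.

Lemma uq_proper :
  ~ rel_ideal (uq_rel (@free_gen F (uq_gen n) : uq_gen n -> uq_free)) 1.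
Proof.
have [c [c1 cD cM cZ cg]] :=
  free_alg_char (fun g : uq_gen n => (uq_toral g)%:R : F).
exact: (uq_rel_proper c1 cD cM cZ cg).
Qed.

Definition Uq := quot_alg uq_proper.
HB.instance Definition _ := GRing.Algebra.on Uq.

Definition uq_gen_val (g : uq_gen n) : Uq := \pi_Uq (free_gen F g : uq_free).
Definition uq_e i : Uq := uq_gen_val (GenE i).
Definition uq_f i : Uq := uq_gen_val (GenF i).
Definition uq_w i : Uq := uq_gen_val (GenW i).
Definition uq_w' i : Uq := uq_gen_val (GenW' i).

Definition Uplus := subalg (fun x : Uq => exists i, x = uq_e i).
HB.instance Definition _ := GRing.Algebra.on Uplus.

Lemma uq_e_subproof i : uq_e i \in subalg_pred (fun x : Uq => exists i, x = uq_e i).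
Proof. by apply/asboolP/GenSubalg_gen; exists i. Qed.

Definition up_e i : Uplus := Subalg (uq_e_subproof i).

Definition skew_eq i (P L R : Uplus) : Prop :=
  val P * uq_f i - uq_f i * val P
  = (uq_r i - uq_s i)^-1 *: (uq_w i * val L - uq_w' i * val R).

(* [skew i P] is the pair (L, R) with [skew_eq i P L R]; it exists and is
   unique (triangular decomposition), and the default value (0, 0) of [xget] is only there to make the
   definition total. *)
Definition skew i (P : Uplus) : Uplus * Uplus :=
  xget (0, 0) [set LR : Uplus * Uplus | skew_eq i P LR.1 LR.2]%classic.

Definition skew_d i (P : Uplus) : Uplus := (skew i P).1.
Definition skew_d' i (P : Uplus) : Uplus := (skew i P).2.

Definition serre_op (D : 'I_n -> Uplus -> Uplus) i j (P : Uplus) : Uplus :=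
  \sum_(k < (serre_len i j).+1)
    serre_coef i j k *: iter (serre_len i j - k) (D i) (D j (iter k (D i) P)).

End Uq.

(* A unital algebra homomorphism from A to the algebra of linear endomorphisms
   of V, with composition as product. *)
Definition end_alg_hom (F : fieldType) (A : algType F) (V : lmodType F)
    (phi : A -> {linear V -> V}) : Prop :=
  [/\ forall v, phi 1 v = v,
      forall x y v, phi (x * y) v = phi x (phi y v)
    & forall a x y v, phi (a *: x + y) v = a *: phi x v + phi y v].

(* Q(r,s) as Frac(Q[r][s]). *)
Definition Qrs : fieldType := {fraction {poly {poly rat}}}.
Definition Qr : Qrs := tofrac 'X%:P.
Definition Qs : Qrs := tofrac 'X.

(* Main.v *)
Require Import Defs.
From HB Require Import structures.
From mathcomp Require Import all_boot all_order all_algebra generic_quotient.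
From mathcomp Require Import boolp classical_sets finmap monalg ring zify.

Set Implicit Arguments.
Unset Strict Implicit.
Unset Printing Implicit Defensive.

Import Order.TTheory GRing.Theory Num.Theory.
Local Open Scope ring_scope.

(** The operators are read off from a right Verma module. Dividing U by the
    right ideal generated by the f_i and by a character of the torus leaves a
    right U-module which should be a copy of U^+: e_j acts by right
    multiplication, omega_i and omega'_i by a_i tau_i and b_i tau'_i, where
    tau_i and tau'_i rescale the generators, and, since
    P f_i = f_i P + (omega_i L - omega'_i R) / (r_i - s_i), the generator f_i acts
    by (a_i d_i - b_i d'_i) / (r_i - s_i) for two skew derivations d_i and d'_i.
    So every relation between the f_i becomes, in reversed order, a relation
    between these combinations; taking b = 0 or a = 0 isolates the d_i or
    the d'_i, and the f-Serre relations turn into the two identities.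

    To avoid presupposing anything about U^+, the module is first built on the
    free algebra T on the e_i. There the relations between e, f and the torus hold
    for all parameters a and b, vanishing ones included ([verma_weak_rel]).
    The only computation is that a Serre element in the e_i commutes with every
    f_l as a consequence of these relations ([serre_e_comm_f]), together with its
    mirror image in the converse algebra ([serre_f_comm_e]). It has two uses.
    The f-Serre operator commutes with all right multiplications and
    kills 1, so it is zero on T ([verma_serre_f]), whence the Serre identities for
    d_i and d'_i ([free_d_serre], [free_d'_serre]). And f_l kills the e-Serre
    elements of T ([verma_f_serre]), so that the ideal J they generate is stable
    under all the operators.

    It remains to descend to U. For nonzero a and b, the action on T respects the
    defining relations of U modulo J ([verma_gen_rel]). Evaluating at 1
    shows that the kernel of T -> U is exactly J ([to_Uq_eq0]), hence U^+ = T / J;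
    varying the parameters a and b shows that omega_i L = omega'_i R with L and R
    in U^+ forces L = R = 0 ([w_to_Uq_inj]). This is the uniqueness that makes
    the operators on U^+ well defined, and they are the ones induced by d_i and d'_i
    ([skew_to_Uplus]). Finally T acts on itself with e_i acting as d_i; the
    elements of J act by zero and J is stable, so U^+ acts on U^+. *)

(** * Gaussian binomial sums *)
Section VintTheory.
Variables (F : fieldType) (v : F).
Hypothesis v1 : v != 1.

Lemma vint0 : vint v 0 = 0.
Proof. by rewrite /vint expr0 subrr mul0r. Qed.

Lemma vintS m : vint v m.+1 = 1 + v * vint v m.
Proof.
have h : v - 1 != 0 by rewrite subr_eq0.
by rewrite /vint exprS; field.
Qed.

Lemma vintD m k : vint v (m + k) = vint v m + v ^+ m * vint v k.
Proof.
have h : v - 1 != 0 by rewrite subr_eq0.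
by rewrite /vint exprD; field.
Qed.

Lemma vint_inv m : v != 0 -> vint v^-1 m.+1 = v ^- m * vint v m.+1.
Proof.
move=> v0; have h : v - 1 != 0 by rewrite subr_eq0.
have h' : 1 - v != 0 by rewrite subr_eq0 eq_sym.
have e : v ^+ m != 0 by rewrite expf_neq0.
by rewrite /vint exprVn exprS; field; rewrite h e v0 mulN1r h'.
Qed.
End VintTheory.

(** The coefficients of the Serre relation enter only through the recursion
    between consecutive terms of a Gaussian binomial sum, here the sequence
    (-1)^k binom(N, k)_v v^(k(k-1)/2) y^k up to a factor. The sum is
    (1 - y)(1 - v y)...(1 - v^(N-1) y); the two vanishing cases below are its
    first and last factors. *)
Section SerreCoefficients.
Variables (F : fieldType) (v y : F) (N : nat) (b : nat -> F).
Hypotheses (v1 : v != 1) (v0 : v != 0) (vN : vint v N != 0).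
Hypothesis b_rec : forall k, (k < N)%N ->
  b k.+1 * vint v k.+1 = - (b k * vint v (N - k) * v ^+ k * y).

(** The partial sums have a closed form, as for alternating sums of binomial
    coefficients; it vanishes at the last index. *)
Lemma qbinom_sum_low : y = 1 -> \sum_(k < N.+1) b k = 0.
Proof.
move=> y1; apply: (mulfI vN); rewrite mulr0.
suff H K : (K <= N)%N ->
    vint v N * (\sum_(k < K.+1) b k) = b K * v ^+ K * vint v (N - K).
  by rewrite (H N) // subnn vint0 mulr0.
elim: K => [_|K IH KN]; first by rewrite big_ord1 expr0 subn0 mulr1 mulrC.
rewrite big_ord_recr /= mulrDr IH 1?ltnW //.
have := b_rec KN; rewrite y1 mulr1 => h.
have -> : b K * v ^+ K * vint v (N - K) = - (b K.+1 * vint v K.+1).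
  by rewrite h opprK mulrAC.
have -> : vint v N = vint v K.+1 + v ^+ K.+1 * vint v (N - K.+1).
  by rewrite -vintD // subnKC.
ring.
Qed.

Lemma qbinom_sum_high : y = v ^- N.-1 -> \sum_(k < N.+1) b k = 0.
Proof.
move=> yE; apply: (mulfI vN); rewrite mulr0.
suff H K : (K <= N)%N ->
    vint v N * (\sum_(k < K.+1) b k) = b K * vint v (N - K).
  by rewrite (H N) // subnn vint0 mulr0.
elim: K => [_|K IH KN]; first by rewrite big_ord1 subn0 mulrC.
rewrite big_ord_recr /= mulrDr IH 1?ltnW //.
have h := b_rec KN.
have -> : b K * vint v (N - K) = - (b K.+1 * vint v K.+1) * v ^+ (N - K.+1).
  rewrite h yE opprK; case: N KN => // M KM; rewrite subSS /=.
  have -> : v ^+ M = v ^+ K * v ^+ (M - K) by rewrite -exprD subnKC.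
  have e1 : v ^+ K != 0 by rewrite expf_neq0.
  have e2 : v ^+ (M - K) != 0 by rewrite expf_neq0.
  by field; rewrite e1 e2.
have -> : vint v N = vint v (N - K.+1) + v ^+ (N - K.+1) * vint v K.+1.
  by rewrite -vintD // subnK.
ring.
Qed.

(** The shape taken by the commutator of a Serre element with f_i: the second
    half of the k-th term cancels the first half of the next one. At the
    two ends the truncated predecessors are harmless because [vint v 0 = 0]. *)
Lemma serre_telescope (A : lmodType F) (X : nat -> nat -> A) :
  \sum_(k < N.+1) b k *: (vint v k *: X (N - k)%N k.-1 +
     (vint v (N - k) * (y * v ^+ k)) *: X (N - k).-1 k) = 0.
Proof.
under eq_bigr do rewrite scalerDr !scalerA.
rewrite big_split big_ord_recl /= vint0 mulr0 scale0r add0r.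
rewrite big_ord_recr /= subnn vint0 mul0r mulr0 scale0r addr0 -big_split /=.
apply: big1 => k _; rewrite /bump add1n /= b_rec // subnS -scalerDl.
by rewrite [X in X *: _](_ : _ = 0) ?scale0r //; ring.
Qed.
End SerreCoefficients.

(** * Converse algebras and skew commutation *)
Section ConverseAlgebra.
Variables (F : fieldType) (A : algType F).

HB.instance Definition _ := GRing.Lmodule.copy A^c A.

Let conv_scalerAl a (x y : A^c) : a *: (x * y) = (a *: x : A^c) * y.
Proof. exact: (@scalerAr F A a y x). Qed.
HB.instance Definition _ := GRing.Lmodule_isLalgebra.Build F A^c conv_scalerAl.

Let conv_scalerAr a (x y : A^c) : a *: (x * y) = x * (a *: y : A^c).
Proof. exact: (@scalerAl F A a y x). Qed.
HB.instance Definition _ := GRing.Lalgebra_isAlgebra.Build F A^c conv_scalerAr.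

End ConverseAlgebra.

Section SkewPowers.
Variables (F : fieldType) (A : algType F).
Implicit Types (e u w f x y : A) (t z : F).

Lemma skew_expr u e t m :
  u * e = t *: (e * u) -> u * e ^+ m = t ^+ m *: (e ^+ m * u).
Proof.
move=> ue; elim: m => [|m IH]; first by rewrite !expr0 scale1r mul1r mulr1.
rewrite !exprSr mulrA IH -scalerAl -[_ * u * e]mulrA ue -scalerAr scalerA.
by rewrite mulrA.
Qed.

Lemma commutator_mul x y f :
  x * y * f - f * (x * y) = x * (y * f - f * y) + (x * f - f * x) * y.
Proof. by rewrite mulrBr mulrBl !mulrA addrA subrK. Qed.

(** The standard formula for [e_i^m, f_i]; the powers of e are pushed to the left
    of w and w', which produces geometric sums in t and t'. *)
Lemma commutator_expr e f w w' z t t' m : t != 1 -> t' != 1 ->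
    e * f - f * e = z *: (w - w') ->
    w * e = t *: (e * w) -> w' * e = t' *: (e * w') ->
  e ^+ m * f - f * e ^+ m =
    z *: (vint t m *: (e ^+ m.-1 * w) - vint t' m *: (e ^+ m.-1 * w')).
Proof.
move=> t1 t'1 ef we w'e; elim: m => [|m IH].
  by rewrite !vint0 !scale0r subrr scaler0 mul1r mulr1 subrr.
have shift u c : u * e = c *: (e * u) ->
    vint c m *: (e ^+ m.-1 * u) * e = (c * vint c m) *: (e ^+ m * u).
  move=> ue; rewrite -scalerAl -[_ * u * e]mulrA ue -scalerAr scalerA [c * _]mulrC.
  by case: (m) => [|k]; rewrite ?vint0 ?mul0r ?scale0r // mulrA -exprSr.
rewrite exprSr commutator_mul IH ef -scalerAr -scalerAl -scalerDr.
rewrite mulrBr mulrBl (shift _ _ we) (shift _ _ w'e) addrACA -opprD /=.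
by rewrite !vintS // !scalerDl !scale1r.
Qed.
End SkewPowers.

(** * The scalars of the quantum group *)
Record generic_datum (F : fieldType) (r s : F) (n : nat) (C : 'M[int]_n)
    (d : 'I_n -> nat) : Prop := GenericDatum {
  generic_r_neq0 : r != 0;
  generic_s_neq0 : s != 0;
  generic_rs : forall m, (0 < m)%N -> (r / s) ^+ m != 1;
  generic_d_gt0 : forall i, (0 < d i)%N;
  generic_d_sym : forall i j, (d i)%:Z * C i j = (d j)%:Z * C j i;
  generic_C_le0 : forall i j, i != j -> C i j <= 0 }.

Section Scalars.
Variables (F : fieldType) (r s : F) (n : nat) (C : 'M[int]_n) (d : 'I_n -> nat).
Hypothesis gen : generic_datum r s C d.
Let r0 := generic_r_neq0 gen.
Let s0 := generic_s_neq0 gen.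
Let rs := generic_rs gen.
Let d_gt0 := generic_d_gt0 gen.
Let d_sym := generic_d_sym gen.
Let C_off := generic_C_le0 gen.

Implicit Types i j l : 'I_n.

(** The scalars c_ij and c'_ij in omega_i e_j = c_ij e_j omega_i and
    omega'_i e_j = c'_ij e_j omega'_i. *)
Definition w_weight i j : F := r ^ euler C d j i * s ^ (- euler C d i j).
Definition w'_weight i j : F := r ^ (- euler C d i j) * s ^ euler C d j i.
Definition q_ratio i : F := uq_r r d i / uq_s s d i.

Local Notation c := w_weight.
Local Notation c' := w'_weight.
Local Notation v := q_ratio.
Local Notation N := (serre_len C).
Local Notation coef := (serre_coef r s C d).

Lemma w_weight_neq0 i j : c i j != 0.
Proof. by rewrite mulf_neq0 // expfz_neq0. Qed.

Lemma w'_weight_neq0 i j : c' i j != 0.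
Proof. by rewrite mulf_neq0 // expfz_neq0. Qed.

Lemma w_weight_inv i j : (c i j)^-1 = c' j i.
Proof. by rewrite /w_weight /w'_weight invfM !invr_expz opprK. Qed.

Lemma w'_weight_inv i j : (c' i j)^-1 = c j i.
Proof. by rewrite -w_weight_inv invrK. Qed.

Lemma q_ratioE i : v i = (r / s) ^+ d i.
Proof. by rewrite /q_ratio /uq_r /uq_s expr_div_n. Qed.

Lemma q_ratio_expr_neq1 i m : (0 < m)%N -> v i ^+ m != 1.
Proof. by move=> m0; rewrite q_ratioE -exprM rs // muln_gt0 d_gt0. Qed.

Lemma q_ratio_neq1 i : v i != 1.
Proof. by have := @q_ratio_expr_neq1 i 1 isT; rewrite expr1. Qed.

Lemma q_ratio_neq0 i : v i != 0.
Proof. by rewrite q_ratioE expf_neq0 // mulf_neq0 // invr_neq0. Qed.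

Lemma vint_q_ratio_neq0 i m : (0 < m)%N -> vint (v i) m != 0.
Proof.
move=> m0; rewrite mulf_neq0 // ?invr_neq0 ?subr_eq0 ?q_ratio_neq1 //.
exact: q_ratio_expr_neq1.
Qed.

Lemma subr_rs_neq0 i : uq_r r d i - uq_s s d i != 0.
Proof.
rewrite subr_eq0; apply: contra_neq (q_ratio_neq1 i) => e.
by rewrite /q_ratio e divff // expf_neq0.
Qed.

Lemma w_weight_diag i : c i i = v i.
Proof.
by rewrite /w_weight /euler ltnn eqxx -invr_expz q_ratioE expr_div_n.
Qed.

Lemma serre_len_gt0 i j : i != j -> (0 < N i j)%N.
Proof. by move/C_off; rewrite /serre_len; case: (C i j) => [[]|]. Qed.

(** This rests on c_ij c_ji = v_i^(a_ij), which holds because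
    <i,j> + <j,i> = d_i a_ij, and on a_ij = 1 - N. *)
Lemma w'_weight_serre i j : i != j -> c' i j = c i j * v i ^+ (N i j).-1.
Proof.
move=> ij; have cij := C_off ij.
have sumE : euler C d i j + euler C d j i = - (d i * (N i j).-1)%N%:Z.
  have -> : (d i * (N i j).-1)%N%:Z = - ((d i)%:Z * C i j).
    by rewrite /serre_len; case: (C i j) cij => [[|m]|m] //=; lia.
  rewrite opprK /euler (negPf ij) eq_sym (negPf ij).
  case: (ltngtP i j) => [lt_ij|lt_ji|/val_inj eq_ij].
  - by rewrite addr0.
  - by rewrite add0r d_sym.
  - by rewrite eq_ij eqxx in ij.
rewrite q_ratioE -exprM -[X in _ = _ * X]/((r / s) ^ _%:Z) -[_%:Z]opprK -sumE.
rewrite /w_weight /w'_weight; set a := euler C d i j; set b := euler C d j i.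
have rs0 : r / s != 0 by rewrite mulf_neq0 ?invr_neq0.
have ra : r ^ a != 0 by rewrite expfz_neq0.
have rb : r ^ b != 0 by rewrite expfz_neq0.
have sa : s ^ a != 0 by rewrite expfz_neq0.
rewrite opprD expfzDr // !expfzMl !exprz_inv !opprK -!invr_expz.
move: ra rb sa; move: (r ^ a) (r ^ b) (s ^ a) (s ^ b) => ra rb sa sb ra0 rb0 sa0.
by field; rewrite ra0 rb0 sa0.
Qed.

Lemma vfact_q_ratio_neq0 i m : vfact (v i) m != 0.
Proof.
rewrite prodf_seq_neq0; apply/allP => q; rewrite mem_index_iota.
by case/andP => q0 _; exact: vint_q_ratio_neq0.
Qed.

Lemma vfactS i m : vfact (v i) m.+1 = vfact (v i) m * vint (v i) m.+1.
Proof. by rewrite /vfact big_nat_recr. Qed.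

Lemma serre_cE i j k :
  serre_c r s C d i j k = v i ^+ (k * k.-1)./2 * c i j ^+ k.
Proof.
rewrite /serre_c -/(v i) -mulrA; congr (_ * _).
by rewrite exprMn -![_ ^+ k]/(_ ^ k%:Z) !exprz_exp mulNr ![_ * k%:Z]mulrC.
Qed.

Lemma serre_coefS i j k : (k < N i j)%N ->
  coef i j k.+1 * vint (v i) k.+1 =
    - (coef i j k * vint (v i) (N i j - k) * v i ^+ k * c i j).
Proof.
move=> kN; rewrite /serre_coef !serre_cE /vbinom -/(v i).
have -> : (N i j - k = (N i j - k.+1).+1)%N by rewrite subnSK.
rewrite !vfactS.
have -> : (k.+1 * k.+1.-1)./2 = ((k * k.-1)./2 + k)%N.
  case: (k) => [//|q]; rewrite !succnK.
  have -> : (q.+2 * q.+1 = q.+1.*2 + q.+1 * q)%N by rewrite -mul2n; ring.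
  by rewrite halfD odd_double andFb add0n doubleK addnC.
rewrite exprD !exprS.
have vi0 m : vint (v i) m.+1 != 0 by apply: vint_q_ratio_neq0.
have := vfact_q_ratio_neq0 i k; have := vfact_q_ratio_neq0 i (N i j - k.+1).
have := vi0 k; have := vi0 (N i j - k.+1)%N.
move: (vint (v i) k.+1) (vint (v i) (N i j - k.+1).+1) (vfact (v i) (N i j)).
move: (vfact (v i) k) (vfact (v i) (N i j - k.+1)) => x1 x2 x3 x4 x5 h1 h2 h3 h4.
by field; rewrite h1 h2 h3 h4.
Qed.
End Scalars.

(** * Serre elements commute with the opposite generators *)

(** The relations between the torus and the e_i, f_i, in a form that does not
    require the torus elements to be invertible: specializing the torus parts w or
    w' to zero is what separates the two families of skew derivations. The
    weights are placed so that exchanging e and f and reversing products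
    preserves the relations. *)
Record weak_uq_rel (F : fieldType) (r s : F) (n : nat) (C : 'M[int]_n)
    (d : 'I_n -> nat) (A : algType F) (e f w w' : 'I_n -> A) : Prop := WeakUqRel {
  weak_we : forall i j, w i * e j = w_weight r s C d i j *: (e j * w i);
  weak_w'e : forall i j, w' i * e j = w'_weight r s C d i j *: (e j * w' i);
  weak_fw : forall i j, f j * w i = w_weight r s C d i j *: (w i * f j);
  weak_fw' : forall i j, f j * w' i = w'_weight r s C d i j *: (w' i * f j);
  weak_ef : forall i j, e i * f j - f j * e i =
    ((i == j)%:R / (uq_r r d i - uq_s s d i)) *: (w i - w' i) }.

Lemma weak_uq_rel_conv (F : fieldType) (r s : F) (n : nat) (C : 'M[int]_n)
    (d : 'I_n -> nat) (A : algType F) (e f w w' : 'I_n -> A) :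
  weak_uq_rel r s C d e f w w' ->
  @weak_uq_rel F r s n C d A^c f e w w'.
Proof.
case=> we w'e fw fw' ef; split=> [i j|i j|i j|i j|i j].
- exact: fw.
- exact: fw'.
- exact: we.
- exact: w'e.
- rewrite -[LHS]/(e j * f i - f i * e j) ef eq_sym.
  by case: eqP => [->//|_]; rewrite !mul0r !scale0r.
Qed.

Section SerreElements.
Variables (F : fieldType) (r s : F) (n : nat) (C : 'M[int]_n) (d : 'I_n -> nat).
Hypothesis gen : generic_datum r s C d.
Variable A : algType F.

Local Notation c := (w_weight r s C d).
Local Notation c' := (w'_weight r s C d).
Local Notation v := (q_ratio r s d).
Local Notation N := (serre_len C).
Local Notation coef := (serre_coef r s C d).

Definition serre_e (e : 'I_n -> A) i j : A :=
  \sum_(k < (N i j).+1) coef i j k *: (e i ^+ (N i j - k) * e j * e i ^+ k).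

Definition serre_f (f : 'I_n -> A) i j : A :=
  \sum_(k < (N i j).+1) coef i j k *: (f i ^+ k * f j * f i ^+ (N i j - k)).

Variables (e f w w' : 'I_n -> A).
Hypothesis rel : weak_uq_rel r s C d e f w w'.

(** These two sums are the coefficients of e_i^N omega_j and e_i^N omega'_j in the
    commutator of the Serre element with f_j. *)
Lemma serre_sum_w i j : i != j ->
  \sum_(k < (N i j).+1) coef i j k * c j i ^+ k = 0.
Proof.
move=> ij; apply: (@qbinom_sum_high F (v i) (v i ^- (N i j).-1) _
  (fun k => coef i j k * c j i ^+ k)) => //.
- exact: q_ratio_neq1 gen _.
- exact: q_ratio_neq0 gen _.
- exact/(vint_q_ratio_neq0 gen)/(serre_len_gt0 gen).
move=> k kN; rewrite mulrAC (serre_coefS gen) // exprSr.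
rewrite -[c j i]w'_weight_inv (w'_weight_serre gen ij).
have c0 := w_weight_neq0 gen i j; have v0 := q_ratio_neq0 gen i.
have e1 : v i ^+ (N i j).-1 != 0 by rewrite expf_neq0.
move: (v i ^+ _.-1) e1 => x x0; rewrite [_^-1 ^+ k]exprVn.
have xk : (c i j * x) ^+ k != 0 by rewrite expf_neq0 // mulf_neq0.
by move: (_ ^+ k) xk => y y0; field; rewrite x0 y0 c0.
Qed.

Lemma serre_sum_w' i j : i != j ->
  \sum_(k < (N i j).+1) coef i j k * c' j i ^+ k = 0.
Proof.
move=> ij; apply: (@qbinom_sum_low F (v i) 1 _
  (fun k => coef i j k * c' j i ^+ k)) => //.
- exact: q_ratio_neq1 gen _.
- exact/(vint_q_ratio_neq0 gen)/(serre_len_gt0 gen).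
move=> k kN; rewrite mulrAC (serre_coefS gen) // exprSr -[c' j i]w_weight_inv.
have c0 := w_weight_neq0 gen i j.
have ck : c i j ^+ k != 0 by rewrite expf_neq0.
by rewrite exprVn; field; rewrite c0 ck.
Qed.

Lemma commutator_serre i j l (T : nat -> A) :
    (forall k, (k <= N i j)%N ->
      e i ^+ (N i j - k) * e j * e i ^+ k * f l -
      f l * (e i ^+ (N i j - k) * e j * e i ^+ k) = T k) ->
  serre_e e i j * f l - f l * serre_e e i j =
    \sum_(k < (N i j).+1) coef i j k *: T k.
Proof.
move=> TE; rewrite mulr_suml mulr_sumr -sumrB; apply: eq_bigr => k _.
by rewrite -scalerAl -scalerAr -scalerBr TE // -ltnS.
Qed.

Lemma w'_weight_diag i : c' i i = (v i)^-1.
Proof. by rewrite -(w_weight_diag _ _ C) w_weight_inv. Qed.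

(** The coefficients satisfy the same recursion for v_i^-1 and c'_ij, which
    handles the omega'_i half of the commutator with f_i. *)
Lemma serre_coefS_inv i j k : i != j -> (k < N i j)%N ->
  coef i j k.+1 * vint (v i)^-1 k.+1 =
    - (coef i j k * vint (v i)^-1 (N i j - k) * (v i)^-1 ^+ k * c' i j).
Proof.
move=> ij kN; have v0 := q_ratio_neq0 gen i; have v1 := q_ratio_neq1 gen i.
rewrite (w'_weight_serre gen ij) vint_inv // mulrCA (serre_coefS gen) //.
have -> : (N i j - k = (N i j - k.+1).+1)%N by rewrite subnSK.
have -> : (N i j).-1 = (N i j - k.+1 + k)%N.
  by lia.
rewrite vint_inv // exprVn exprD.
have e1 : v i ^+ k != 0 by rewrite expf_neq0.
have e2 : v i ^+ (N i j - k.+1) != 0 by rewrite expf_neq0.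
move: (v i ^+ k) (v i ^+ _) e1 e2 => x y x0 y0.
by field; rewrite x0 y0.
Qed.

Lemma e_comm_f k l : k != l -> e k * f l - f l * e k = 0.
Proof. by move=> kl; rewrite (weak_ef rel) (negPf kl) mul0r scale0r. Qed.

Lemma serre_e_comm_f_other i j l : i != l -> j != l ->
  serre_e e i j * f l = f l * serre_e e i j.
Proof.
move=> il jl; have comm m : m != l -> GRing.comm (f l) (e m).
  by move=> /e_comm_f /eqP; rewrite subr_eq0 /GRing.comm => /eqP ->.
apply/commr_sym/commr_sum => k _; rewrite /GRing.comm -scalerAr -scalerAl.
congr (_ *: _).
by apply: commrM; [apply: commrM; [apply: commrX|]|apply: commrX]; apply: comm.
Qed.

(** In the commutator with f_i, each of omega_i and omega'_i contributes a
    combination of e_i^(N-1-k) e_j e_i^k; both telescope to zero. *)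
Lemma serre_e_comm_f_left i j : i != j ->
  serre_e e i j * f i = f i * serre_e e i j.
Proof.
move=> ij; apply/eqP; rewrite -subr_eq0; apply/eqP.
set z := (uq_r r d i - uq_s s d i)^-1.
pose X u a b := e i ^+ a * e j * e i ^+ b * u : A.
pose H t y u k := vint t k *: X u (N i j - k)%N k.-1 +
  (vint t (N i j - k) * (y * t ^+ k)) *: X u (N i j - k).-1 k.
have wi u t y m k : u * e i = t *: (e i * u) -> u * e j = y *: (e j * u) ->
    e i ^+ m * u * e j * e i ^+ k = (y * t ^+ k) *: X u m k.
  move=> ui uj; rewrite -[_ * u * _]mulrA uj -scalerAr -scalerAl -!mulrA.
  by rewrite (skew_expr _ ui) -!scalerAr scalerA /X !mulrA.
rewrite (commutator_serre (T := fun k => z *: (H (v i) (c i j) (w i) k -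
   H (v i)^-1 (c' i j) (w' i) k))).
  under eq_bigr do rewrite scalerA mulrC -scalerA scalerBr.
  rewrite -scaler_sumr sumrB.
  rewrite (serre_telescope (b := coef i j) (fun k kN => serre_coefS gen kN)).
  rewrite (serre_telescope (b := coef i j) (fun k kN => serre_coefS_inv ij kN)).
  by rewrite subr0 scaler0.
have v1 := q_ratio_neq1 gen i.
have v'1 : (v i)^-1 != 1 by rewrite invr_eq1.
have wii : w i * e i = v i *: (e i * w i) by rewrite (weak_we rel) w_weight_diag.
have w'ii : w' i * e i = (v i)^-1 *: (e i * w' i).
  by rewrite (weak_w'e rel) w'_weight_diag.
have efi : e i * f i - f i * e i = z *: (w i - w' i).
  by rewrite (weak_ef rel) eqxx mul1r.
have eX m := commutator_expr m v1 v'1 efi wii w'ii.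
move=> k _; rewrite !commutator_mul !eX (@e_comm_f j) 1?eq_sym // mulr0 add0r.
rewrite -!scalerAl -scalerAr -scalerDr mulrBr !mulrBl addrACA -opprD.
rewrite -!scalerAl -!scalerAr !(wi _ _ _ _ _ wii (weak_we rel i j)).
rewrite !(wi _ _ _ _ _ w'ii (weak_w'e rel i j)) !scalerA /H /X !mulrA.
by [].
Qed.

Lemma serre_e_comm_f_right i j : i != j ->
  serre_e e i j * f j = f j * serre_e e i j.
Proof.
move=> ij; apply/eqP; rewrite -subr_eq0; apply/eqP.
set z := (uq_r r d j - uq_s s d j)^-1.
rewrite (commutator_serre (T := fun k => z *: (c j i ^+ k *: (e i ^+ N i j * w j)
    - c' j i ^+ k *: (e i ^+ N i j * w' j)))).
  under eq_bigr do rewrite scalerA mulrC -scalerA scalerBr !scalerA.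
  rewrite -scaler_sumr sumrB -!scaler_suml serre_sum_w // serre_sum_w' //.
  by rewrite !scale0r subr0 scaler0.
have efi m : e i ^+ m * f j - f j * e i ^+ m = 0.
  apply/eqP; rewrite subr_eq0; apply/eqP/esym/commrX/eqP.
  by rewrite -subr_eq0 -opprB oppr_eq0 e_comm_f.
move=> k kN; rewrite !commutator_mul !efi mulr0 add0r mul0r addr0.
rewrite (weak_ef rel) eqxx mul1r -/z -scalerAr -scalerAl mulrBr mulrBl.
rewrite -!mulrA (skew_expr _ (weak_we rel j i)) (skew_expr _ (weak_w'e rel j i)).
by rewrite -!scalerAr !mulrA -exprD subnK.
Qed.

(** For l = i the commutator telescopes, for l = j its coefficients are vanishing
    Gaussian binomial sums, and any other f_l commutes with both e_i and e_j. *)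
Lemma serre_e_comm_f i j l : i != j -> serre_e e i j * f l = f l * serre_e e i j.
Proof.
move=> ij; have [<-|il] := eqVneq i l; first exact: serre_e_comm_f_left.
have [<-|jl] := eqVneq j l; first exact: serre_e_comm_f_right.
exact: serre_e_comm_f_other.
Qed.
End SerreElements.

Lemma serre_f_comm_e (F : fieldType) (r s : F) (n : nat) (C : 'M[int]_n)
    (d : 'I_n -> nat) (gen : generic_datum r s C d) (A : algType F)
    (e f w w' : 'I_n -> A) (rel : weak_uq_rel r s C d e f w w') i j l :
  i != j -> serre_f r s C d f i j * e l = e l * serre_f r s C d f i j.
Proof.
move=> ij; have := serre_e_comm_f gen (weak_uq_rel_conv rel) l ij.
have -> : @serre_e F r s n C d A^c f i j = serre_f r s C d f i j.
  apply: eq_bigr => k _.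
  by rewrite !revrX -[in RHS]mulrA.
exact: esym.
Qed.

(** * Homomorphisms out of a free algebra *)
Section FreeAlgebraHom.
Variables (F : fieldType) (X : choiceType).
Local Notation T := (free_alg F X).

(** Building words letter by letter from the right matches the right action of
    the e_i. *)
Lemma free_alg_ind_right (P : T -> Prop) :
    P 1 -> (forall y x, P y -> P (y * free_gen F x)) ->
    (forall a x y, P x -> P y -> P (a *: x + y)) ->
  forall x, P x.
Proof.
move=> P1 PM Plin.
have P0 : P 0 by rewrite -(subrr 1) addrC -scaleN1r; apply: Plin.
have Pmon (m : seq X) : P (<< fmonom_of_seq fmonom_key m >> : T).
  elim/last_ind: m => [|m x IH]; first exact: P1.
  suff -> : (<< fmonom_of_seq fmonom_key (rcons m x) >> : T) =
      (<< fmonom_of_seq fmonom_key m >> : T) * free_gen F x by apply: PM.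
  rewrite [free_gen]unlock; apply: (etrans _ (esym (malgM_def _ _))).
  rewrite fgmulUU mulr1; congr << _ *g _ >>.
  by rewrite -[RHS]fmK fmM fmU !fmE /= cats1.
have monE x : x = \sum_(k <- msupp x) x@_k *: (<< k >> : T).
  apply: (etrans (monalgE (x : {malg F[{fmonom X}]}))); apply: eq_bigr => k _.
  by apply/malgP => k'; rewrite (mcoeffZ x@_k) !mcoeffU mulr_natr.
move=> x; rewrite (monE x); elim/big_rec: _ => // k y _ Py; apply: Plin => //.
by have := Pmon k; rewrite fmE fmK.
Qed.

Variables (A : algType F) (h : X -> A).

Let hm (m : {fmonom X}) : A := \prod_(x <- m : seq _) h x.
Let hm_morph : mmorphism hm.
Proof. by split=> [x y|]; rewrite /hm ?fmM ?big_cat // fm1 big_nil. Qed.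
HB.instance Definition _ :=
  monalg.isMultiplicative.Build {fmonom X} A hm hm_morph.

Definition free_hom : T -> A := mmap (in_alg A) hm.

Lemma free_hom_gen x : free_hom (free_gen F x) = h x.
Proof. by rewrite unlock /free_hom mmapU /= /hm fmU big_seq1 scale1r mul1r. Qed.

Lemma free_hom_multiplicative : multiplicative free_hom.
Proof.
apply: commr_mmap_is_multiplicative => g m m'; rewrite /GRing.comm /=.
by rewrite mulr_algl mulr_algr.
Qed.

Lemma free_hom_linear : linear free_hom.
Proof.
move=> a x y; rewrite /free_hom mmapD; congr (_ + _).
by rewrite mmapZ /= mulr_algl.
Qed.
HB.instance Definition _ :=
  GRing.isLinear.Build F T A *:%R free_hom free_hom_linear.
HB.instance Definition _ :=
  GRing.isMultiplicative.Build T A free_hom free_hom_multiplicative.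

End FreeAlgebraHom.

(** * The algebra of linear endomorphisms *)
Section LinearEndomorphisms.
Variables (F : fieldType) (V : algType F).

Record lin_end := LinEnd { lin_fun :> V -> V; lin_funP : linear lin_fun }.

HB.instance Definition _ (f : lin_end) :=
  GRing.isLinear.Build F V V *:%R (lin_fun f) (@lin_funP f).

Lemma lin_endP (f g : lin_end) : f =1 g -> f = g.
Proof.
case: f g => [f f_lin] [g g_lin] /= /funext fg; case: _ / fg in g_lin *.
by congr LinEnd; apply: Prop_irrelevance.
Qed.

HB.instance Definition _ := gen_eqMixin lin_end.
HB.instance Definition _ := gen_choiceMixin lin_end.

Implicit Types (f g : lin_end) (a : F) (x y : V).

Let zero_lin : linear (fun _ : V => 0 : V).
Proof. by move=> a x y; rewrite scaler0 addr0. Qed.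
Let opp_lin f : linear (fun x => - f x).
Proof. by move=> a x y; rewrite linearP opprD scalerN. Qed.
Let add_lin f g : linear (fun x => f x + g x).
Proof. by move=> a x y; rewrite !linearP scalerDr addrACA. Qed.
Let id_lin : linear (fun x : V => x).
Proof. by []. Qed.
Let comp_lin f g : linear (fun x => f (g x)).
Proof. by move=> a x y; rewrite !linearP. Qed.
Let scale_lin a f : linear (fun x => a *: f x).
Proof. by move=> b x y; rewrite linearP scalerDr !scalerA mulrC. Qed.

Let endD f g := LinEnd (add_lin f g).
Let endM f g := LinEnd (comp_lin f g).
Let endZ a f := LinEnd (scale_lin a f).

Let endDA : associative endD.
Proof. by move=> f g h; apply: lin_endP => x; apply: addrA. Qed.
Let endDC : commutative endD.
Proof. by move=> f g; apply: lin_endP => x; apply: addrC. Qed.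
Let end0D : left_id (LinEnd zero_lin) endD.
Proof. by move=> f; apply: lin_endP => x; apply: add0r. Qed.
Let endND : left_inverse (LinEnd zero_lin) (fun f => LinEnd (opp_lin f)) endD.
Proof. by move=> f; apply: lin_endP => x; apply: addNr. Qed.
HB.instance Definition _ := GRing.isZmodule.Build lin_end endDA endDC end0D endND.

Let endMA : associative endM.
Proof. by move=> f g h; apply: lin_endP. Qed.
Let end1M : left_id (LinEnd id_lin) endM.
Proof. by move=> f; apply: lin_endP. Qed.
Let endM1 : right_id (LinEnd id_lin) endM.
Proof. by move=> f; apply: lin_endP. Qed.
Let endMDl : left_distributive endM +%R.
Proof. by move=> f g h; apply: lin_endP. Qed.
Let endMDr : right_distributive endM +%R.
Proof. by move=> f g h; apply: lin_endP => x; apply: raddfD. Qed.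
Let end1_neq0 : LinEnd id_lin != 0.
Proof. by apply/eqP => /(congr1 (fun f : lin_end => f 1)) /eqP; rewrite oner_eq0. Qed.
HB.instance Definition _ := GRing.Zmodule_isNzRing.Build lin_end
  endMA end1M endM1 endMDl endMDr end1_neq0.

Let endZA a b f : endZ a (endZ b f) = endZ (a * b) f.
Proof. by apply: lin_endP => x; apply: scalerA. Qed.
Let end1Z : left_id 1 endZ.
Proof. by move=> f; apply: lin_endP => x; apply: scale1r. Qed.
Let endZDr : right_distributive endZ +%R.
Proof. by move=> a f g; apply: lin_endP => x; apply: scalerDr. Qed.
Let endZDl f : {morph endZ^~ f : a b / a + b}.
Proof. by move=> a b; apply: lin_endP => x; apply: scalerDl. Qed.
HB.instance Definition _ := GRing.Zmodule_isLmodule.Build F lin_end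
  endZA end1Z endZDr endZDl.

Let endZAl a f g : a *: (f * g) = (a *: f) * g.
Proof. exact: lin_endP. Qed.
HB.instance Definition _ := GRing.Lmodule_isLalgebra.Build F lin_end endZAl.
Let endZAr a f g : a *: (f * g) = f * (a *: g).
Proof. by apply: lin_endP => x; rewrite -[RHS]/(f (a *: g x)) linearZ. Qed.
HB.instance Definition _ := GRing.Lalgebra_isAlgebra.Build F lin_end endZAr.

Lemma lin_end0E x : (0 : lin_end) x = 0. Proof. by []. Qed.
Lemma lin_endDE f g x : (f + g) x = f x + g x. Proof. by []. Qed.
Lemma lin_endNE f x : (- f) x = - f x. Proof. by []. Qed.
Lemma lin_endME f g x : (f * g) x = f (g x). Proof. by []. Qed.
Lemma lin_endZE a f x : (a *: f) x = a *: f x. Proof. by []. Qed.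

Lemma lin_endXE f m x : (f ^+ m) x = iter m f x.
Proof. by elim: m => // m IH; rewrite exprS lin_endME IH. Qed.

Lemma lin_end_sumE (I : Type) (t : seq I) (P : pred I) (G : I -> lin_end) x :
  (\sum_(i <- t | P i) G i) x = \sum_(i <- t | P i) G i x.
Proof. by elim/big_rec2: _ => // i y f _ <-. Qed.

End LinearEndomorphisms.

(** * Skew derivations of a free algebra *)

(** A free algebra seen through its universal property only, so that nothing
    below depends on how words are represented. *)
Record free_algebra_on (F : fieldType) (X : Type) (T : algType F) (g : X -> T) :=
  FreeAlgebraOn {
    free_lift : forall A : algType F, (X -> A) -> {lrmorphism T -> A};
    free_lift_gen : forall (A : algType F) (h : X -> A) x, free_lift h (g x) = h x;
    free_ind_right : forall P : T -> Prop, P 1 ->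
      (forall y x, P y -> P (y * g x)) ->
      (forall a x y, P x -> P y -> P (a *: x + y)) -> forall x, P x }.

Definition free_alg_free (F : fieldType) (X : choiceType) :
    @free_algebra_on F X (free_alg F X) (@free_gen F X) :=
  @FreeAlgebraOn F X (free_alg F X) (@free_gen F X) (fun A h => @free_hom F X A h)
    (@free_hom_gen F X) (@free_alg_ind_right F X).

Section SkewDerivation.
Variables (F : fieldType) (X : eqType) (T : algType F) (g : X -> T).
Variable T_free : free_algebra_on g.
Implicit Types (t u : X -> F) (x y : T) (i j k : X).

Lemma free_ind (P : T -> Prop) : P 1 -> (forall j, P (g j)) ->
    (forall x y, P x -> P y -> P (x * y)) ->
    (forall a x y, P x -> P y -> P (a *: x + y)) ->
  forall x, P x.
Proof.
by move=> P1 Pg PM Plin; apply: (free_ind_right T_free) => // y x Py; apply: PM.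
Qed.

Definition scale_hom t : {lrmorphism T -> T} :=
  free_lift T_free (fun j => t j *: g j).

Lemma scale_hom_gen t j : scale_hom t (g j) = t j *: g j.
Proof. exact: free_lift_gen. Qed.

(* A skew derivation D with twist t amounts to the algebra homomorphism
   x |-> [[x, 0], [D x, t(x)]] into lower triangular matrices, acting here on
   pairs; D x is then read off from the image of the column (1, 0). *)
Let skew_fun t i j (p : T * T) : T * T :=
  (g j * p.1, (j == i)%:R *: p.1 + t j *: (g j * p.2)).

Let skew_fun_linear t i j : linear (skew_fun t i j).
Proof.
move=> a p q; rewrite /skew_fun /=; congr (_, _).
  by rewrite mulrDr -scalerAr.
rewrite -[RHS]/(a *: ((j == i)%:R *: p.1 + t j *: (g j * p.2)) +
  ((j == i)%:R *: q.1 + t j *: (g j * q.2))).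
rewrite mulrDr -scalerAr !scalerDr !scalerA -!addrA ![a * _]mulrC; congr (_ + _).
by rewrite addrCA.
Qed.

Let skew_hom t i : {lrmorphism T -> lin_end (T * T)%type} :=
  free_lift T_free (fun j => LinEnd (skew_fun_linear t i j)).

Definition skew_der t i x : T := (skew_hom t i x (1, 0)).2.

Let skew_homE t i x p : skew_hom t i x p =
  (x * p.1, skew_der t i x * p.1 + scale_hom t x * p.2).
Proof.
rewrite /skew_der; elim/free_ind: x p => [|j|x y IHx IHy|a x y IHx IHy] p.
- by rewrite !rmorph1 /= mul0r add0r !mul1r; case: p.
- rewrite free_lift_gen /= scale_hom_gen /skew_fun /= mulr0 scaler0 addr0.
  by rewrite -!scalerAl mul1r.
- rewrite !rmorphM /= IHx IHy [in RHS]IHx [(skew_hom t i y) _]IHy /=.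
  rewrite !mulr1 !mulr0 !addr0.
  by rewrite mulrDr mulrDl !mulrA addrA.
- rewrite !linearP !lin_endDE !lin_endZE IHx IHy !mulrDl -!scalerAl.
  by congr (_, _); rewrite -[LHS]/(a *: (_ + _) + (_ + _)) scalerDr addrACA.
Qed.

Lemma skew_der_linear t i : linear (skew_der t i).
Proof. by move=> a x y; rewrite /skew_der linearP. Qed.
HB.instance Definition _ t i :=
  GRing.isLinear.Build F T T *:%R (skew_der t i) (skew_der_linear t i).

Lemma skew_der1 t i : skew_der t i 1 = 0.
Proof. by rewrite /skew_der rmorph1. Qed.

Lemma skew_der_gen t i j : skew_der t i (g j) = (j == i)%:R.
Proof.
by rewrite /skew_der free_lift_gen /= mulr0 scaler0 addr0 scaler_nat.
Qed.

Lemma skew_derM t i x y :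
  skew_der t i (x * y) = skew_der t i x * y + scale_hom t x * skew_der t i y.
Proof.
by rewrite {1}/skew_der rmorphM lin_endME !skew_homE /= !mulr1 !mulr0 !addr0.
Qed.

Lemma scale_homC t u x : scale_hom t (scale_hom u x) = scale_hom u (scale_hom t x).
Proof.
elim/free_ind: x => [|j|x y IHx IHy|a x y IHx IHy].
- by rewrite !rmorph1.
- by rewrite !scale_hom_gen !linearZ /= !scale_hom_gen !scalerA mulrC.
- by rewrite !rmorphM /= IHx IHy.
- by rewrite !linearP /= IHx IHy.
Qed.

Lemma scale_homK t u : (forall j, t j * u j = 1) ->
  cancel (scale_hom t) (scale_hom u).
Proof.
move=> tu; elim/free_ind => [|j|x y IHx IHy|a x y IHx IHy].
- by rewrite !rmorph1.
- by rewrite scale_hom_gen linearZ /= scale_hom_gen scalerA tu scale1r.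
- by rewrite !rmorphM /= IHx IHy.
- by rewrite !linearP /= IHx IHy.
Qed.

Lemma skew_der_scale_hom t u i x :
  skew_der t i (scale_hom u x) = u i *: scale_hom u (skew_der t i x).
Proof.
elim/free_ind: x => [|j|x y IHx IHy|a x y IHx IHy].
- by rewrite !rmorph1 skew_der1 linear0 scaler0.
- rewrite scale_hom_gen linearZ /= skew_der_gen rmorph_nat.
  by case: eqVneq => [->//|_]; rewrite !scaler0.
- rewrite rmorphM !skew_derM linearD !rmorphM /= IHx IHy.
  by rewrite scale_homC -scalerAl -scalerAr -scalerDr.
- rewrite [scale_hom u (_ + _)]linearP [skew_der t i (a *: x + y)]linearP.
  rewrite [LHS]linearP [scale_hom u (_ + _)]linearP /= IHx IHy.
  by rewrite scalerDr !scalerA [u i * a]mulrC.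
Qed.

End SkewDerivation.

(** * The right Verma modules on the free algebra *)
Section SerreMorphisms.
Variables (F : fieldType) (r s : F) (n : nat) (C : 'M[int]_n) (d : 'I_n -> nat).

Lemma serre_e_morph (A B : algType F) (phi : {lrmorphism A -> B})
    (e : 'I_n -> A) i j :
  phi (serre_e r s C d e i j) = serre_e r s C d (phi \o e) i j.
Proof.
rewrite linear_sum; apply: eq_bigr => k _.
by rewrite linearZ /= !rmorphM !rmorphXn.
Qed.

Lemma serre_f_conv (A : algType F) (f : 'I_n -> A) i j :
  @serre_f F r s n C d A^c f i j = serre_e r s C d f i j.
Proof. by apply: eq_bigr => k _; rewrite !revrX -[in RHS]mulrA. Qed.

Lemma serre_e_scale (A : algType F) (t : 'I_n -> F) (e : 'I_n -> A) i j :
  serre_e r s C d (fun l => t l *: e l) i j =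
  (t i ^+ serre_len C i j * t j) *: serre_e r s C d e i j.
Proof.
rewrite scaler_sumr; apply: eq_bigr => k _.
rewrite !exprZn -!scalerAl -!scalerAr -!scalerAl !scalerA.
have -> : t i ^+ serre_len C i j = t i ^+ (serre_len C i j - k) * t i ^+ k.
  by rewrite -exprD subnK // -ltnS.
by congr (_ *: _); ring.
Qed.
End SerreMorphisms.

Section RightMultiplication.
Variables (F : fieldType) (A : algType F).

Let rmul_linear (x : A) : linear ( *%R^~ x).
Proof. by move=> a y z; rewrite mulrDl scalerAl. Qed.

(** Right operators compose in the reverse order, so right multiplication is a
    homomorphism into the converse of the endomorphism algebra. *)
Definition rmul (x : A) : (lin_end A)^c := LinEnd (rmul_linear x).

Let rmul_is_linear : linear rmul.
Proof. by move=> a x y; apply: lin_endP => z /=; rewrite mulrDr scalerAr. Qed.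
HB.instance Definition _ :=
  GRing.isLinear.Build F A (lin_end A)^c *:%R rmul rmul_is_linear.

Let rmul_multiplicative : multiplicative rmul.
Proof.
split=> [x y|]; apply: lin_endP => z /=; last exact: mulr1.
exact: mulrA.
Qed.
HB.instance Definition _ :=
  GRing.isMultiplicative.Build A (lin_end A)^c rmul rmul_multiplicative.

Lemma rmulE x y : rmul x y = y * x. Proof. by []. Qed.
End RightMultiplication.

Section SkewOperators.
Variables (F : fieldType) (r s : F) (n : nat) (C : 'M[int]_n) (d : 'I_n -> nat).
Hypothesis gen : generic_datum r s C d.
Variables (T : algType F) (g : 'I_n -> T).
Variable T_free : free_algebra_on g.

Local Notation c := (w_weight r s C d).
Local Notation c' := (w'_weight r s C d).
Local Notation N := (serre_len C).

Definition skew_end t i : lin_end T := LinEnd (skew_der_linear T_free t i).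
Definition scale_end t : lin_end T := LinEnd (linearP (scale_hom T_free t)).

Definition free_d i := skew_end (fun j => (c i j)^-1) i.
Definition free_d' i := skew_end (fun j => (c' i j)^-1) i.
Definition free_tau i := scale_end (fun j => (c i j)^-1).
Definition free_tau' i := scale_end (fun j => (c' i j)^-1).

(** The action of f_i, omega_i and omega'_i on the right Verma module whose highest
    weight sends omega_i to a_i and omega'_i to b_i. *)
Definition verma_f (a b : 'I_n -> F) i : (lin_end T)^c :=
  (uq_r r d i - uq_s s d i)^-1 *: (a i *: free_d i - b i *: free_d' i).
Definition verma_w (a : 'I_n -> F) i : (lin_end T)^c := a i *: free_tau i.
Definition verma_w' (b : 'I_n -> F) i : (lin_end T)^c := b i *: free_tau' i.

Lemma verma_fE a b i x : verma_f a b i x =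
  (uq_r r d i - uq_s s d i)^-1 *: (a i *: free_d i x - b i *: free_d' i x).
Proof. by []. Qed.

Lemma verma_wE a i x : verma_w a i x = a i *: free_tau i x.
Proof. by []. Qed.

Lemma verma_w'E b i x : verma_w' b i x = b i *: free_tau' i x.
Proof. by []. Qed.

Lemma conv_endME (f h : (lin_end T)^c) x : (f * h) x = h (f x).
Proof. by []. Qed.

Lemma free_dM i x y : free_d i (x * y) = free_d i x * y + free_tau i x * free_d i y.
Proof. exact: skew_derM. Qed.

Lemma free_d'M i x y :
  free_d' i (x * y) = free_d' i x * y + free_tau' i x * free_d' i y.
Proof. exact: skew_derM. Qed.

Lemma free_d_gen i j : free_d i (g j) = (j == i)%:R.
Proof. exact: skew_der_gen. Qed.

Lemma free_d'_gen i j : free_d' i (g j) = (j == i)%:R.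
Proof. exact: skew_der_gen. Qed.

Lemma scale_end_Mgen t x j : scale_end t (x * g j) = t j *: (scale_end t x * g j).
Proof.
rewrite -[LHS]/(scale_hom T_free t (x * g j)) rmorphM /= scale_hom_gen.
by rewrite -scalerAr.
Qed.

Lemma verma_weak_rel a b :
  weak_uq_rel r s C d (fun i => rmul (g i)) (verma_f a b)
    (verma_w a) (verma_w' b).
Proof.
have linZ (f : lin_end T) k x : f (k *: x) = k *: f x by exact: linearZ.
have linB (f : lin_end T) x y : f (x - y) = f x - f y by exact: linearB.
have c0 i j : c i j != 0 := w_weight_neq0 gen i j.
have c'0 i j : c' i j != 0 := w'_weight_neq0 gen i j.
have tau_gen i x j : free_tau i (x * g j) = (c i j)^-1 *: (free_tau i x * g j).
  exact: scale_end_Mgen.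
have tau'_gen i x j : free_tau' i (x * g j) = (c' i j)^-1 *: (free_tau' i x * g j).
  exact: scale_end_Mgen.
have dtau i j x : free_d j (free_tau i x) = (c i j)^-1 *: free_tau i (free_d j x).
  exact: skew_der_scale_hom.
have d'tau i j x : free_d' j (free_tau i x) = (c i j)^-1 *: free_tau i (free_d' j x).
  exact: skew_der_scale_hom.
have dtau' i j x : free_d j (free_tau' i x) = (c' i j)^-1 *: free_tau' i (free_d j x).
  exact: skew_der_scale_hom.
have d'tau' i j x :
    free_d' j (free_tau' i x) = (c' i j)^-1 *: free_tau' i (free_d' j x).
  exact: skew_der_scale_hom.
split=> [i j|i j|i j|i j|i j]; apply: lin_endP => x.
- rewrite lin_endZE !conv_endME !verma_wE !rmulE tau_gen.
  by rewrite !scalerA mulrAC divff // mul1r scalerAl.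
- rewrite lin_endZE !conv_endME !verma_w'E !rmulE tau'_gen.
  by rewrite !scalerA mulrAC divff // mul1r scalerAl.
- rewrite lin_endZE !conv_endME !verma_wE !verma_fE !linZ linB !linZ dtau d'tau.
  rewrite !scalerBr !scalerA; have := c0 i j; move: (_ - _)^-1 => z cij.
  by congr (_ *: _ - _ *: _); field.
- rewrite lin_endZE !conv_endME !verma_w'E !verma_fE !linZ linB !linZ dtau' d'tau'.
  rewrite !scalerBr !scalerA; have := c'0 i j; move: (_ - _)^-1 => z cij.
  by congr (_ *: _ - _ *: _); field.
- rewrite lin_endDE lin_endNE !conv_endME [RHS]lin_endZE lin_endDE lin_endNE.
  rewrite verma_wE verma_w'E !verma_fE !rmulE free_dM free_d'M.
  rewrite free_d_gen free_d'_gen -scalerAl mulrBl -!scalerAl -scalerBr.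
  rewrite [a j *: (_ + _)]scalerDr [b j *: (_ + _)]scalerDr.
  have cancel_add (p q p' q' : T) : p + q - (p' + q') - (p - p') = q - q'.
    by rewrite opprD addrACA [_ + (q - q')]addrC addrK.
  rewrite cancel_add.
  case: eqVneq => [->|_]; first by rewrite !mulr1 mul1r.
  by rewrite !mulr0 !scaler0 subr0 scaler0 mul0r scale0r.
Qed.

(** The f-Serre operator commutes with right multiplication by the generators, so
    it is determined by its value at 1, and every f_i kills 1. *)
Lemma verma_serre_f a b i j : i != j ->
  serre_f r s C d (verma_f a b) i j = 0.
Proof.
move=> ij; have comm l x := congr1 (fun f : lin_end T => f x)
  (serre_f_comm_e gen (verma_weak_rel a b) l ij).
apply: lin_endP; elim/(free_ind_right T_free) => [|y l IH|k x y IHx IHy].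
- rewrite serre_f_conv lin_end_sumE big1 // => k _.
  have f1 l : verma_f a b l 1 = 0.
    by rewrite verma_fE /= !skew_der1 !scaler0 subr0 scaler0.
  rewrite lin_endZE !lin_endME !lin_endXE.
  have iter0 m l : iter m (verma_f a b l) 0 = 0.
    by elim: m => // m IH; rewrite iterS IH; apply: (linear0 (verma_f a b l : lin_end T)).
  have -> : verma_f a b j (iter k (verma_f a b i) 1) = 0.
    case: (nat_of_ord k) => [|m]; first exact: f1.
    by rewrite iterSr f1 iter0; apply: (linear0 (verma_f a b j : lin_end T)).
  by rewrite iter0 scaler0.
- by have := comm l y; rewrite !conv_endME !rmulE IH lin_end0E mul0r => <-.
- rewrite lin_end0E in IHx IHy *.
  have lin (f : lin_end T) : f (k *: x + y) = k *: f x + f y by exact: linearP.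
  by rewrite (lin (serre_f r s C d (verma_f a b) i j)) IHx IHy scaler0 addr0.
Qed.

(** Commuting the e-Serre element past f_l reduces its image to f_l applied
    to 1. *)
Lemma verma_f_serre a b i j l : i != j -> verma_f a b l (serre_e r s C d g i j) = 0.
Proof.
move=> ij; have := serre_e_comm_f gen (verma_weak_rel a b) l ij.
rewrite -(serre_e_morph r s C d (@rmul F T)) => /(congr1 (fun f : lin_end T => f 1)).
rewrite !conv_endME !rmulE mul1r => ->.
by rewrite verma_fE /= !skew_der1 !scaler0 subr0 scaler0 mul0r.
Qed.

(** The parameters at which the action of f_i reduces to a single skew
    derivation. *)
Lemma verma_f_left a b i : a i = uq_r r d i - uq_s s d i -> b i = 0 ->
  verma_f a b i = free_d i.
Proof.
move=> ai bi; rewrite /verma_f ai bi scale0r subr0 scalerA.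
by rewrite mulVf ?scale1r // (subr_rs_neq0 gen).
Qed.

Lemma verma_f_right a b i : a i = 0 -> b i = - (uq_r r d i - uq_s s d i) ->
  verma_f a b i = free_d' i.
Proof.
move=> ai bi; rewrite /verma_f ai bi scale0r sub0r scaleNr opprK scalerA.
by rewrite mulVf ?scale1r // (subr_rs_neq0 gen).
Qed.

Lemma free_d_serre i j : i != j -> serre_e r s C d free_d i j = 0.
Proof.
move=> ij; rewrite -serre_f_conv.
pose a l := uq_r r d l - uq_s s d l.
have <- : verma_f a (fun=> 0) = free_d by apply: funext => l; apply: verma_f_left.
exact: verma_serre_f.
Qed.

Lemma free_d'_serre i j : i != j -> serre_e r s C d free_d' i j = 0.
Proof.
move=> ij; rewrite -serre_f_conv.
pose b l := - (uq_r r d l - uq_s s d l).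
have <- : verma_f (fun=> 0) b = free_d' by apply: funext => l; apply: verma_f_right.
exact: verma_serre_f.
Qed.

Lemma serre_free_d i j l : i != j -> free_d l (serre_e r s C d g i j) = 0.
Proof.
pose a l := uq_r r d l - uq_s s d l => ij.
by rewrite -(@verma_f_left a (fun=> 0)) //; apply: verma_f_serre.
Qed.

Lemma serre_free_d' i j l : i != j -> free_d' l (serre_e r s C d g i j) = 0.
Proof.
pose b l := - (uq_r r d l - uq_s s d l) => ij.
by rewrite -(@verma_f_right (fun=> 0) b) //; apply: verma_f_serre.
Qed.

Definition serre_rel (x y : T) : Prop :=
  exists i j, [/\ i != j, x = serre_e r s C d g i j & y = 0].

Definition serre_ideal : T -> Prop := rel_ideal serre_rel.

Lemma serre_idealZ a x : serre_ideal x -> serre_ideal (a *: x).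
Proof. by move=> Jx; rewrite -mulr_algl; apply: RelIdeal_Ml. Qed.

Lemma serre_idealB x y : serre_ideal x -> serre_ideal y -> serre_ideal (x - y).
Proof.
by move=> Jx Jy; apply: RelIdeal_D => //; rewrite -scaleN1r; apply: serre_idealZ.
Qed.

(** The Serre elements are homogeneous, hence eigenvectors of the rescalings. *)
Lemma scale_end_serre_ideal t x : serre_ideal x -> serre_ideal (scale_end t x).
Proof.
elim=> [_ _ [i [j [ij -> ->]]]||y z _ Jy _ Jz|a y _ Jy|a y _ Jy].
- rewrite subr0 /= serre_e_morph.
  have -> : scale_hom T_free t \o g = fun l => t l *: g l.
    by apply: funext => l; apply: scale_hom_gen.
  rewrite serre_e_scale; apply: serre_idealZ; rewrite -[serre_e _ _ _ _ _ _ _]subr0.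
  by apply: RelIdeal_rel; exists i, j.
- by rewrite linear0; apply: RelIdeal_0.
- by rewrite linearD; apply: RelIdeal_D.
- by rewrite /= rmorphM; apply: RelIdeal_Ml.
- by rewrite /= rmorphM; apply: RelIdeal_Mr.
Qed.

Lemma skew_end_serre_ideal t l :
    (forall i j, i != j -> skew_end t l (serre_e r s C d g i j) = 0) ->
  forall x, serre_ideal x -> serre_ideal (skew_end t l x).
Proof.
move=> S0 x; elim=> [_ _ [i [j [ij -> ->]]]||y z _ Jy _ Jz|a y yJ Jy|a y yJ Jy].
- by rewrite subr0 S0 //; apply: RelIdeal_0.
- by rewrite linear0; apply: RelIdeal_0.
- by rewrite linearD; apply: RelIdeal_D.
- rewrite /= skew_derM; apply: RelIdeal_D; first exact: RelIdeal_Ml.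
  by apply: RelIdeal_Ml.
- rewrite /= skew_derM; apply: RelIdeal_D; apply: RelIdeal_Mr => //.
  exact: scale_end_serre_ideal.
Qed.

Lemma free_d_serre_ideal i x : serre_ideal x -> serre_ideal (free_d i x).
Proof. by apply: skew_end_serre_ideal => j k; apply: serre_free_d. Qed.

Lemma free_d'_serre_ideal i x : serre_ideal x -> serre_ideal (free_d' i x).
Proof. by apply: skew_end_serre_ideal => j k; apply: serre_free_d'. Qed.
End SkewOperators.

(** * The positive part as a quotient of the free algebra *)
Lemma uq_rel_morph (F : fieldType) (r s : F) (n : nat) (C : 'M[int]_n)
    (d : 'I_n -> nat) (A B : algType F) (phi : {lrmorphism A -> B})
    (gen : uq_gen n -> A) (u v : A) :
  uq_rel r s C d gen u v -> uq_rel r s C d (phi \o gen) (phi u) (phi v).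
Proof.
case=> [k l kt lt|i|i|i j|i j|i j|i j|i j|i j ij|i j ij].
- by rewrite !rmorphM; apply: Uq_toral_comm.
- by rewrite !rmorphM rmorph1; apply: Uq_WV.
- by rewrite !rmorphM rmorph1; apply: Uq_W'V.
- by rewrite linearZ !rmorphM; apply: Uq_WE.
- by rewrite linearZ !rmorphM; apply: Uq_W'E.
- by rewrite linearZ !rmorphM; apply: Uq_WF.
- by rewrite linearZ !rmorphM; apply: Uq_W'F.
- by rewrite linearZ !linearB !rmorphM; apply: Uq_EF.
- rewrite -[\sum_k _]/(serre_e r s C d (fun l => gen (GenE l)) i j).
  by rewrite serre_e_morph linear0; apply: Uq_serreE.
- rewrite linear0 linear_sum.
  under eq_bigr do rewrite linearZ /= !rmorphM !rmorphXn.
  exact: (Uq_serreF _ _ _ _ (phi \o gen)).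
Qed.

Section PositivePart.
Variables (F : fieldType) (r s : F) (n : nat) (C : 'M[int]_n) (d : 'I_n -> nat).
Hypothesis gen : generic_datum r s C d.
Variables (T : algType F) (g : 'I_n -> T).
Variable T_free : free_algebra_on g.

Local Notation c := (w_weight r s C d).
Local Notation c' := (w'_weight r s C d).
Local Notation N := (serre_len C).
Local Notation U := (Uq r s C d).
Local Notation Up := (Uplus r s C d).
Local Notation J := (serre_ideal r s C d g).
Local Notation free_d := (free_d r s C d T_free).
Local Notation free_d' := (free_d' r s C d T_free).
Local Notation free_tau := (free_tau r s C d T_free).
Local Notation free_tau' := (free_tau' r s C d T_free).

Local Notation pi_U := (\pi_U%qT : uq_free F n -> U).
Local Notation val_gen := (@uq_gen_val F r s n C d).

Lemma uq_piM x y : pi_U (x * y) = pi_U x * pi_U y.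
Proof. by rewrite -[RHS]/(qa_mul _ _) qa_pi_mul. Qed.

Lemma uq_piP a x y : pi_U (a *: x + y) = a *: pi_U x + pi_U y.
Proof. by rewrite -[RHS]/(qa_add (qa_scale _ _) _) qa_pi_scale qa_pi_add. Qed.

Lemma uq_piZ a x : pi_U (a *: x) = a *: pi_U x.
Proof. by rewrite -[RHS]/(qa_scale _ _) qa_pi_scale. Qed.

Lemma uq_piB x y : pi_U (x - y) = pi_U x - pi_U y.
Proof. by rewrite -scaleN1r addrC uq_piP scaleN1r addrC. Qed.

Lemma uq_relE x y :
  uq_rel r s C d (@free_gen F (uq_gen n)) x y -> pi_U x = pi_U y.
Proof. by move=> xy; apply/quot_algP/RelIdeal_rel. Qed.

Let commute_of_conj (w wi e : U) k : w * wi = 1 -> wi * w = 1 ->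
  w * e * wi = k *: e -> w * e = k *: (e * w).
Proof. by move=> wwi wiw h; rewrite scalerAl -h -!mulrA wiw mulr1. Qed.

Let w_inv i : val_gen (GenW i) * val_gen (GenWi i) = 1.
Proof. by rewrite -uq_piM (uq_relE (Uq_WV _ _ _ _ _ i)). Qed.

Let w_invl i : val_gen (GenWi i) * val_gen (GenW i) = 1.
Proof. by rewrite -(w_inv i) -!uq_piM; apply: uq_relE; apply: Uq_toral_comm. Qed.

Let w'_inv i : val_gen (GenW' i) * val_gen (GenWi' i) = 1.
Proof. by rewrite -uq_piM (uq_relE (Uq_W'V _ _ _ _ _ i)). Qed.

Let w'_invl i : val_gen (GenWi' i) * val_gen (GenW' i) = 1.
Proof. by rewrite -(w'_inv i) -!uq_piM; apply: uq_relE; apply: Uq_toral_comm. Qed.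

Lemma uq_we i j :
  uq_w r s C d i * uq_e r s C d j = c i j *: (uq_e r s C d j * uq_w r s C d i).
Proof.
apply: (commute_of_conj (w_inv i) (w_invl i)).
by rewrite -!uq_piM -uq_piZ; apply: uq_relE; apply: Uq_WE.
Qed.

Lemma uq_w'e i j :
  uq_w' r s C d i * uq_e r s C d j = c' i j *: (uq_e r s C d j * uq_w' r s C d i).
Proof.
apply: (commute_of_conj (w'_inv i) (w'_invl i)).
by rewrite -!uq_piM -uq_piZ; apply: uq_relE; apply: Uq_W'E.
Qed.

Lemma uq_ef i j :
  uq_e r s C d i * uq_f r s C d j - uq_f r s C d j * uq_e r s C d i =
  ((i == j)%:R / (uq_r r d i - uq_s s d i)) *: (uq_w r s C d i - uq_w' r s C d i).
Proof.
by rewrite -!uq_piM -!uq_piB -uq_piZ; apply: uq_relE; apply: Uq_EF.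
Qed.

Definition free_e : {lrmorphism T -> uq_free F n} :=
  free_lift T_free (fun i => free_gen F (GenE i)).

Definition to_Uq : {lrmorphism T -> U} := free_lift T_free (@uq_e F r s n C d).

Definition to_Uplus : {lrmorphism T -> Up} := free_lift T_free (@up_e F r s n C d).

Lemma to_UqE x : to_Uq x = pi_U (free_e x).
Proof.
elim/(free_ind T_free): x => [|j|x y IHx IHy|a x y IHx IHy].
- by rewrite !rmorph1.
- by rewrite !free_lift_gen.
- by rewrite !rmorphM /= IHx IHy uq_piM.
- by rewrite !linearP /= IHx IHy uq_piP.
Qed.

Lemma val_to_Uplus x : val (to_Uplus x) = to_Uq x.
Proof.
elim/(free_ind T_free): x => [|j|x y IHx IHy|a x y IHx IHy].
- by rewrite !rmorph1.
- by rewrite !free_lift_gen.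
- by rewrite !rmorphM /= IHx IHy.
- by rewrite !linearP /= IHx IHy.
Qed.

Lemma to_Uplus_surj (P : Up) : exists x, to_Uplus x = P.
Proof.
suff [x xP] : exists x, to_Uq x = val P.
  by exists x; apply: val_inj; rewrite /= val_to_Uplus.
have /asboolP : val P \in subalg_pred (fun x : U => exists i, x = uq_e r s C d i).
  by case: P.
elim=> [_ [i ->]||a x y _ [u <-] _ [v <-]|x y _ [u <-] _ [v <-]].
- by exists (g i); rewrite free_lift_gen.
- by exists 1; rewrite rmorph1.
- by exists (a *: u + v); rewrite linearP.
- by exists (u * v); rewrite rmorphM.
Qed.

Lemma to_Uq_w i x : to_Uq x * uq_w r s C d i = uq_w r s C d i * to_Uq (free_tau i x).
Proof.
elim/(free_ind T_free): x => [|j|x y IHx IHy|a x y IHx IHy].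
- by rewrite /= !rmorph1 mulr1 mul1r.
- rewrite /= scale_hom_gen linearZ /= free_lift_gen -scalerAr uq_we scalerA.
  by rewrite mulVf ?scale1r // w_weight_neq0.
- by rewrite /= !rmorphM -mulrA [X in _ * X]IHy mulrA [X in X * _]IHx -mulrA.
- by rewrite /= !linearP /= mulrDl mulrDr -scalerAl -scalerAr IHx IHy.
Qed.

Lemma to_Uq_w' i x :
  to_Uq x * uq_w' r s C d i = uq_w' r s C d i * to_Uq (free_tau' i x).
Proof.
elim/(free_ind T_free): x => [|j|x y IHx IHy|a x y IHx IHy].
- by rewrite /= !rmorph1 mulr1 mul1r.
- rewrite /= scale_hom_gen linearZ /= free_lift_gen -scalerAr uq_w'e scalerA.
  by rewrite mulVf ?scale1r // w'_weight_neq0.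
- by rewrite /= !rmorphM -mulrA [X in _ * X]IHy mulrA [X in X * _]IHx -mulrA.
- by rewrite /= !linearP /= mulrDl mulrDr -scalerAl -scalerAr IHx IHy.
Qed.

(** Existence of the skew differential operators: the defining identity holds on
    generators, and both sides obey the same twisted Leibniz rule. *)
Lemma to_Uq_comm_f i x :
  to_Uq x * uq_f r s C d i - uq_f r s C d i * to_Uq x =
  (uq_r r d i - uq_s s d i)^-1 *:
    (uq_w r s C d i * to_Uq (free_d i x) - uq_w' r s C d i * to_Uq (free_d' i x)).
Proof.
elim/(free_ind T_free): x => [|j|x y IHx IHy|a x y IHx IHy].
- by rewrite /= !skew_der1 !rmorph1 !linear0 mulr1 mul1r !mulr0 !subrr scaler0.
- rewrite free_d_gen free_d'_gen free_lift_gen uq_ef.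
  case: eqVneq => [->|_]; first by rewrite !rmorph1 !mulr1 mul1r.
  by rewrite mul0r scale0r !linear0 !mulr0 subrr scaler0.
- rewrite rmorphM commutator_mul IHx IHy free_dM free_d'M !rmorphD !rmorphM /=.
  rewrite -scalerAr -scalerAl -scalerDr; congr (_ *: _).
  rewrite mulrBr mulrBl !mulrDr !mulrA to_Uq_w to_Uq_w' /= opprD.
  by rewrite addrC addrACA.
- rewrite !linearP /= mulrDl mulrDr -scalerAl -scalerAr opprD addrACA -scalerBr.
  rewrite IHx IHy.
  rewrite scalerA mulrC -scalerA -scalerDr; congr (_ *: _).
  by rewrite !mulrDr -!scalerAr opprD addrACA -scalerBr.
Qed.

Definition verma_gen (a b : 'I_n -> F) (x : uq_gen n) : (lin_end T)^c :=
  match x with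
  | GenE i => rmul (g i)
  | GenF i => verma_f r s C d T_free a b i
  | GenW i => verma_w r s C d T_free a i
  | GenWi i => (a i)^-1 *: scale_end T_free (c i)
  | GenW' i => verma_w' r s C d T_free b i
  | GenWi' i => (b i)^-1 *: scale_end T_free (c' i)
  end.

Definition verma a b : {lrmorphism uq_free F n -> (lin_end T)^c} :=
  free_lift (free_alg_free F (uq_gen n)) (verma_gen a b).

Lemma verma_genE a b x : verma a b (free_gen F x) = verma_gen a b x.
Proof. exact: free_lift_gen. Qed.

Lemma verma_free_e a b x : verma a b (free_e x) = rmul x.
Proof.
elim/(free_ind T_free): x => [|j|x y IHx IHy|k x y IHx IHy].
- by rewrite !rmorph1.
- by rewrite free_lift_gen verma_genE.
- by rewrite !rmorphM /= IHx IHy.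
- by rewrite !linearP /= IHx IHy.
Qed.

Lemma verma_ideal a b u x : J x -> J (verma a b u x).
Proof.
elim/(free_ind (free_alg_free F (uq_gen n))): u x =>
  [|l|u v IHu IHv|k u v IHu IHv] x Jx.
- by rewrite rmorph1.
- rewrite verma_genE; case: l => i /=.
  + exact: RelIdeal_Mr.
  + apply/serre_idealZ/serre_idealB; apply: serre_idealZ.
      exact: (free_d_serre_ideal gen).
    exact: (free_d'_serre_ideal gen).
  + exact/serre_idealZ/scale_end_serre_ideal.
  + exact/serre_idealZ/scale_end_serre_ideal.
  + exact/serre_idealZ/scale_end_serre_ideal.
  + exact/serre_idealZ/scale_end_serre_ideal.
- by rewrite rmorphM conv_endME; apply/IHv/IHu.
- rewrite linearP lin_endDE lin_endZE; apply: RelIdeal_D; last exact: IHv.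
  by apply: serre_idealZ; apply: IHu.
Qed.

Lemma scale_endK t u : (forall j, t j * u j = 1) ->
  scale_end T_free u * scale_end T_free t = 1.
Proof. by move=> tu; apply: lin_endP => x; apply: scale_homK. Qed.

(** All relations hold exactly on T, except the e-Serre relations: these act by
    right multiplication by a Serre element, whose image is in J. *)
Lemma verma_gen_rel a b u v : (forall i, a i != 0) -> (forall i, b i != 0) ->
  uq_rel r s C d (verma_gen a b) u v -> forall x, J (u x - v x).
Proof.
move=> a0 b0 uv x; have eqJ : u = v -> J (u x - v x).
  by move=> ->; rewrite subrr; apply: RelIdeal_0.
have rel := verma_weak_rel gen T_free a b.
have c0 i j : c i j != 0 := w_weight_neq0 gen i j.
have c'0 i j : c' i j != 0 := w'_weight_neq0 gen i j.
have wwi i : verma_w r s C d T_free a i * ((a i)^-1 *: scale_end T_free (c i)) = 1.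
  rewrite -scalerAl -scalerAr scalerA divff // scale1r.
  by apply: scale_endK => j; rewrite mulVf.
have w'w'i i :
    verma_w' r s C d T_free b i * ((b i)^-1 *: scale_end T_free (c' i)) = 1.
  rewrite -scalerAl -scalerAr scalerA divff // scale1r.
  by apply: scale_endK => j; rewrite mulVf.
have conj (w wi e : (lin_end T)^c) k : k != 0 -> w * wi = 1 ->
    e * w = k *: (w * e) -> w * e * wi = k^-1 *: e.
  move=> k0 h ew; have -> : w * e = k^-1 *: (e * w).
    by rewrite ew scalerA mulVf ?scale1r.
  by rewrite -scalerAl -mulrA h mulr1.
have conj' (w wi e : (lin_end T)^c) k : w * wi = 1 ->
    w * e = k *: (e * w) -> w * e * wi = k *: e.
  by move=> h ->; rewrite -scalerAl -mulrA h mulr1.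
case: uv eqJ => [k l kt lt|i|i|i j|i j|i j|i j|i j|i j ij|i j ij] eqJ.
- apply: eqJ.
  have torE m : uq_toral m -> exists y t, verma_gen a b m = y *: scale_end T_free t.
    by case: m => // i _; do 2!eexists.
  have [y [t ->]] := torE k kt; have [z [u' ->]] := torE l lt.
  rewrite -!scalerAl -!scalerAr !scalerA [y * z]mulrC; congr (_ *: _).
  by apply: lin_endP => p; apply: scale_homC.
- exact/eqJ/wwi.
- exact/eqJ/w'w'i.
- apply: eqJ; exact: conj' (wwi i) (weak_we rel i j).
- apply: eqJ; exact: conj' (w'w'i i) (weak_w'e rel i j).
- apply: eqJ; apply: etrans (conj _ _ _ _ (c0 i j) (wwi i) (weak_fw rel i j)) _.
  by rewrite w_weight_inv.
- apply: eqJ; apply: etrans (conj _ _ _ _ (c'0 i j) (w'w'i i) (weak_fw' rel i j)) _.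
  by rewrite w'_weight_inv.
- exact/eqJ/(weak_ef rel).
- rewrite -[\sum_k _]/(serre_e r s C d (fun l => rmul (g l)) i j).
  rewrite -(serre_e_morph r s C d (@rmul F T)) rmulE subr0; apply: RelIdeal_Ml.
  rewrite -[serre_e _ _ _ _ _ _ _]subr0.
  by apply: RelIdeal_rel; exists i, j.
- apply: eqJ; exact: (verma_serre_f gen T_free a b ij).
Qed.

Lemma verma_rel_ideal a b u : (forall i, a i != 0) -> (forall i, b i != 0) ->
    rel_ideal (uq_rel r s C d (@free_gen F (uq_gen n))) u ->
  forall x, J (verma a b u x).
Proof.
move=> a0 b0; elim=> [u' v uv x||u' v _ Ju _ Jv x|u' v _ Jv x|u' v _ Jv x].
- rewrite linearB lin_endDE lin_endNE; apply: (verma_gen_rel a0 b0).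
  have := uq_rel_morph (verma a b) uv.
  rewrite (_ : verma a b \o _ = verma_gen a b) //.
  by apply: funext => k; apply: verma_genE.
- by move=> x; rewrite linear0; apply: RelIdeal_0.
- by rewrite linearD lin_endDE; apply: RelIdeal_D; [apply: Ju|apply: Jv].
- by rewrite rmorphM conv_endME; apply: Jv.
- by rewrite rmorphM conv_endME; apply: verma_ideal; apply: Jv.
Qed.

Lemma to_Uq_serre_ideal x : J x -> to_Uq x = 0.
Proof.
elim=> [_ _ [i [j [ij -> ->]]]||y z _ Jy _ Jz|a y _ Jy|a y _ Jy].
- rewrite subr0 to_UqE serre_e_morph.
  have -> : free_e \o g = fun l => free_gen F (GenE l).
    by apply: funext => l; apply: free_lift_gen.
  have h := uq_relE (@Uq_serreE F r s n C d _ (@free_gen F (uq_gen n)) i j ij).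
  by apply: (etrans h); rewrite -(subrr 0) uq_piB subrr.
- by rewrite linear0.
- by rewrite linearD /= Jy Jz addr0.
- by rewrite rmorphM /= Jy mulr0.
- by rewrite rmorphM /= Jy mul0r.
Qed.

(** An element of T acts by right multiplication, so it is recovered, modulo J,
    from its action on 1. *)
Lemma to_Uq_eq0 x : to_Uq x = 0 <-> J x.
Proof.
split=> [|/to_Uq_serre_ideal //].
rewrite to_UqE => /quot_algP; rewrite subr0 => /verma_rel_ideal Jx.
have := Jx (fun=> 1) (fun=> 1) (fun=> oner_neq0 _) (fun=> oner_neq0 _) 1.
by rewrite verma_free_e rmulE mul1r.
Qed.

Lemma verma_gen_free_e a b k l x y :
  verma a b (free_gen F k * free_e x - free_gen F l * free_e y) 1 =
  verma_gen a b k 1 * x - verma_gen a b l 1 * y.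
Proof.
have vermaM u v : verma a b (u * v) = verma a b u * verma a b v by exact: rmorphM.
have vermaB u v z : verma a b (u - v) z = verma a b u z - verma a b v z.
  have E : verma a b (u - v) = verma a b u - verma a b v by exact: linearB.
  by rewrite E.
have mulE m z : verma a b (free_gen F m * free_e z) 1 = verma_gen a b m 1 * z.
  by rewrite vermaM conv_endME verma_genE verma_free_e.
apply: (etrans (vermaB _ _ _)).
exact: (congr2 (fun p q => p - q) (mulE k x) (mulE l y)).
Qed.

(** Acting on 1 with the parameters (a, b) gives a x = b y modulo J; the choices
    (1, 1) and (1, v_i) then separate x and y. *)
Lemma w_to_Uq_inj i x y :
  uq_w r s C d i * to_Uq x = uq_w' r s C d i * to_Uq y -> J x /\ J y.
Proof.
rewrite !to_UqE -!uq_piM => /quot_algP /verma_rel_ideal Jxy.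
have J_lin a b : a != 0 -> b != 0 -> J (a *: x - b *: y).
  move=> a0 b0; have := Jxy (fun=> a) (fun=> b) (fun=> a0) (fun=> b0) 1.
  rewrite (verma_gen_free_e (fun=> a) (fun=> b) (GenW i) (GenW' i) x y).
  rewrite [verma_gen _ _ (GenW i) _]verma_wE [verma_gen _ _ (GenW' i) _]verma_w'E.
  by rewrite /= !rmorph1 -!scalerAl !mul1r.
have v0 := q_ratio_neq0 gen i; have v1 := q_ratio_neq1 gen i.
have Jxy1 : J (x - y).
  by have := J_lin 1 1; rewrite !scale1r; apply; apply: oner_neq0.
have Jy : J y.
  have Jv : J ((q_ratio r s d i - 1) *: y).
    have := serre_idealB Jxy1 (J_lin 1 _ (oner_neq0 _) v0).
    by rewrite scale1r opprB addrC subrKA scalerBl scale1r.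
  rewrite -[y]scale1r -(mulVf (_ : q_ratio r s d i - 1 != 0)) ?subr_eq0 //.
  by rewrite -scalerA; apply: serre_idealZ.
by split=> //; rewrite -[x](subrK y); apply: RelIdeal_D.
Qed.

Lemma skew_eq_to_Uplus i x : skew_eq i (to_Uplus x) (to_Uplus (free_d i x))
  (to_Uplus (free_d' i x)).
Proof. by rewrite /skew_eq !val_to_Uplus to_Uq_comm_f. Qed.

Lemma skew_eq_unique i P L R L' R' :
  @skew_eq F r s n C d i P L R -> skew_eq i P L' R' -> L = L' /\ R = R'.
Proof.
have [x <-] := to_Uplus_surj L; have [y <-] := to_Uplus_surj R.
have [x' <-] := to_Uplus_surj L'; have [y' <-] := to_Uplus_surj R'.
rewrite /skew_eq => -> /(scalerI (invr_neq0 (subr_rs_neq0 gen i))).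
rewrite !val_to_Uplus => /eqP; rewrite subr_eq -addrA addrC -subr_eq.
rewrite addrC -mulrBr -mulrBr -!linearB /= => /eqP /w_to_Uq_inj [Jx Jy].
by split; apply: val_inj; rewrite !val_to_Uplus; apply/eqP;
  rewrite -subr_eq0 -linearB; apply/eqP/to_Uq_serre_ideal.
Qed.

Lemma skew_to_Uplus i x : Defs.skew i (to_Uplus x) =
  (to_Uplus (free_d i x), to_Uplus (free_d' i x)).
Proof.
have ex : [set LR : Up * Up | skew_eq i (to_Uplus x) LR.1 LR.2]%classic
    (to_Uplus (free_d i x), to_Uplus (free_d' i x)).
  exact: skew_eq_to_Uplus.
have := xgetPex (0, 0) (ex_intro _ _ ex).
rewrite -/(Defs.skew i (to_Uplus x)); case: (Defs.skew i _) => L R /= h.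
by have [-> ->] := skew_eq_unique h (skew_eq_to_Uplus i x).
Qed.

Lemma skew_d_to_Uplus i x : skew_d i (to_Uplus x) = to_Uplus (free_d i x).
Proof. by rewrite /skew_d skew_to_Uplus. Qed.

Lemma skew_d'_to_Uplus i x : skew_d' i (to_Uplus x) = to_Uplus (free_d' i x).
Proof. by rewrite /skew_d' skew_to_Uplus. Qed.

Lemma to_Uplus_eq x y : J (x - y) -> to_Uplus x = to_Uplus y.
Proof.
move=> Jxy; apply: val_inj; rewrite !val_to_Uplus; apply/eqP.
by rewrite -subr_eq0 -linearB; apply/eqP/to_Uq_serre_ideal.
Qed.

Lemma to_Uplus_eqJ x y : to_Uplus x = to_Uplus y -> J (x - y).
Proof.
move=> /(congr1 val); rewrite !val_to_Uplus => xy; apply/to_Uq_eq0.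
by rewrite linearB /= xy subrr.
Qed.

(** * Realizations by skew differential operators *)

(** Operators D on T that satisfy the Serre identities and preserve J induce
    operators on U^+ = T / J and an action of U^+ by words in them; it is applied to
    both families of skew derivations. *)
Section Realization.
Variables (D : 'I_n -> lin_end T) (D_up : 'I_n -> Up -> Up).
Hypothesis D_serre : forall i j, i != j -> serre_e r s C d D i j = 0.
Hypothesis D_ideal : forall i x, J x -> J (D i x).
Hypothesis D_upE : forall i x, D_up i (to_Uplus x) = to_Uplus (D i x).

Lemma serre_op_eq0 i j P : i != j -> serre_op D_up i j P = 0.
Proof.
move=> ij; have [x <-] := to_Uplus_surj P.
have iterE k l y : iter k (D_up l) (to_Uplus y) = to_Uplus (iter k (D l) y).
  by elim: k => //= k ->.
rewrite -(linear0 to_Uplus) -[0 in RHS]/((0 : lin_end T) x) -(D_serre ij).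
rewrite lin_end_sumE linear_sum; apply: eq_bigr => k _.
by rewrite iterE D_upE iterE lin_endZE !lin_endME !lin_endXE linearZ.
Qed.

Let free_act : {lrmorphism T -> lin_end T} := free_lift T_free D.

Let free_act_ideal y x : J x -> J (free_act y x).
Proof.
elim/(free_ind T_free): y x => [|j|y z IHy IHz|a y z IHy IHz] x Jx.
- by rewrite rmorph1.
- by rewrite free_lift_gen; apply: D_ideal.
- by rewrite rmorphM; apply/IHy/IHz.
- rewrite linearP lin_endDE lin_endZE; apply: RelIdeal_D; last exact: IHz.
  by apply: serre_idealZ; apply: IHy.
Qed.

Let free_act_serre_ideal y : J y -> free_act y = 0.
Proof.
elim=> [_ _ [i [j [ij -> ->]]]||x z _ Jx _ Jz|a z _ Jz|a z _ Jz].
- rewrite subr0 serre_e_morph.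
  have -> : free_act \o g = D by apply: funext => l; apply: free_lift_gen.
  exact: D_serre.
- by rewrite linear0.
- by rewrite linearD /= Jx Jz addr0.
- by rewrite rmorphM /= Jz mulr0.
- by rewrite rmorphM /= Jz mul0r.
Qed.

(* The action of U^+ is computed on arbitrary preimages in T; [up_actE] shows
   that the choice does not matter. *)
Let pre (P : Up) : T := sval (cid (to_Uplus_surj P)).

Let preK P : to_Uplus (pre P) = P.
Proof. exact: (svalP (cid (to_Uplus_surj P))). Qed.

Let up_act (P Q : Up) : Up := to_Uplus (free_act (pre P) (pre Q)).

Let up_actE y x : up_act (to_Uplus y) (to_Uplus x) = to_Uplus (free_act y x).
Proof.
have Jy : J (pre (to_Uplus y) - y) by apply: to_Uplus_eqJ; rewrite preK.
have Jx : J (pre (to_Uplus x) - x) by apply: to_Uplus_eqJ; rewrite preK.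
have /eqP : free_act (pre (to_Uplus y) - y) = 0 by apply: free_act_serre_ideal.
rewrite linearB subr_eq0 => /eqP act_y.
apply: to_Uplus_eq; rewrite act_y -linearB.
exact: free_act_ideal.
Qed.

Let up_act_linear P : linear (up_act P).
Proof.
move=> a Q R; rewrite -[P]preK -[Q]preK -[R]preK -linearP !up_actE.
by rewrite linearP linearP.
Qed.

Lemma realization : exists phi : Up -> {linear Up -> Up},
  end_alg_hom phi /\ forall i P, phi (up_e r s C d i) P = D_up i P.
Proof.
pose phi P : {linear Up -> Up} :=
  HB.pack (up_act P) (GRing.isLinear.Build F Up Up *:%R (up_act P) (@up_act_linear P)).
have phiE P Q : phi P Q = up_act P Q by [].
exists phi; split; first split.
- by move=> Q; rewrite phiE -[Q]preK -(rmorph1 to_Uplus) up_actE rmorph1.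
- move=> P Q R; rewrite !phiE -[P]preK -[Q]preK -[R]preK -rmorphM !up_actE.
  by rewrite rmorphM.
- move=> a P Q R; rewrite !phiE -[P]preK -[Q]preK -[R]preK -linearP !up_actE.
  by rewrite !linearP.
move=> i P; rewrite phiE -[P]preK D_upE.
have -> : up_e r s C d i = to_Uplus (g i) by rewrite free_lift_gen.
by rewrite up_actE free_lift_gen.
Qed.
End Realization.
End PositivePart.

(** * The field of rational functions in r and s *)
Lemma expr_div_neq1 (F : fieldType) (x y : F) m :
  y != 0 -> x ^+ m != y ^+ m -> (x / y) ^+ m != 1.
Proof.
move=> y0; apply: contra_neq; rewrite expr_div_n => h.
by rewrite -[RHS]mul1r -h divfK // expf_neq0.
Qed.

Lemma Qs_neq0 : Qs != 0.
Proof. by rewrite /Qs tofrac_eq0 polyX_eq0. Qed.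

Lemma Qr_neq0 : Qr != 0.
Proof. by rewrite /Qr tofrac_eq0 polyC_eq0 polyX_eq0. Qed.

Lemma Qr_Qs_generic m : (0 < m)%N -> (Qr / Qs) ^+ m != 1.
Proof.
move=> m0; apply: expr_div_neq1; first exact: Qs_neq0.
have neq : ('X%:P : {poly {poly rat}}) ^+ m != 'X^m.
  apply/eqP => /(congr1 (fun p : {poly {poly rat}} => size p)) /eqP.
  by rewrite -rmorphXn size_polyXn size_polyC; case: (_ != 0); case: m m0.
move: neq; by rewrite -tofrac_eq !tofracXn.
Qed.

Theorem theorem4p3 (n : nat) (C : 'M[int]_n) (d : 'I_n -> nat)
    (C_finite : cartan_finite_type C)
    (d_gt0 : forall i, (0 < d i)%N)
    (d_sym : forall i j, (d i)%:Z * C i j = (d j)%:Z * C j i)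
    (d_coprime : \big[gcdn/0%N]_i d i = 1%N) :
  [/\ forall i j : 'I_n, i != j -> forall P : Uplus Qr Qs C d,
        serre_op (@skew_d Qrs Qr Qs n C d) i j P = 0,
      forall i j : 'I_n, i != j -> forall P : Uplus Qr Qs C d,
        serre_op (@skew_d' Qrs Qr Qs n C d) i j P = 0,
      exists phi : Uplus Qr Qs C d -> {linear Uplus Qr Qs C d -> Uplus Qr Qs C d},
        end_alg_hom phi /\ forall i P, phi (up_e Qr Qs C d i) P = skew_d i P
    & exists phi : Uplus Qr Qs C d -> {linear Uplus Qr Qs C d -> Uplus Qr Qs C d},
        end_alg_hom phi /\ forall i P, phi (up_e Qr Qs C d i) P = skew_d' i P].
Proof.
have gen : generic_datum Qr Qs C d.
  split=> //; last by case: C_finite.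
  - exact: Qr_neq0.
  - exact: Qs_neq0.
  - exact: Qr_Qs_generic.
have free := free_alg_free Qrs 'I_n.
have dS := free_d_serre gen free; have d'S := free_d'_serre gen free.
have dJ := free_d_serre_ideal gen free; have d'J := free_d'_serre_ideal gen free.
have dE := skew_d_to_Uplus gen free; have d'E := skew_d'_to_Uplus gen free.
split.
- by move=> i j ij P; apply: (serre_op_eq0 dS dE P ij).
- by move=> i j ij P; apply: (serre_op_eq0 d'S d'E P ij).
- exact: (realization gen dS dJ dE).
- exact: (realization gen d'S d'J d'E).
Qed.
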